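(* Consider $N,j\in\mathbb{N}$, let $X(j)$ be the state at time $j$, and let $\mu_N^2$ be a measurable feedback law from Algorithm 2 for $x_j=X(j,\omega)$. Then $\mu_N^2$ coincides $P_{X(j)}$-almost surely with a feedback law $\mu_N^1$ from Algorithm 1, and the identity $$J^{cl}_K(X_0,\mu_N^1)=J^{cl}_K(X_0,\mu_N^2)$$ holds for all $X_0\in\mathcal{R}(\Omega,\mathcal{X})$ (and all $K\in\mathbb{N}$).
   Context: Setting. $\mathcal{X},\mathcal{U},\mathcal{W}$ are Borel spaces, $f:\mathcal{X}\times\mathcal{U}\times\mathcal{W}\to\mathcal{X}$ is continuous, $g:\mathcal{X}\times\mathcal{U}\to\mathbb{R}$ is continuous and bounded from below, and $(\Omega,\mathcal{B}(\Omega),\mathbb{P})$ is a probability space. $\mathcal{R}(\Omega,\mathcal{X})$ is the set of measurable maps $(\Omega,\mathcal{B}(\Omega))\to(\mathcal{X},\mathcal{B}(\mathcal{X}))$ (random variables), similarly for $\mathcal{U},\mathcal{W}$; $P_X(A):=\mathbb{P}(X^{-1}(A))$ is the distribution of $X$. Consider the system $X(k+1)=f(X(k),U(k),W(k))$, $X(0)=X_0$, with $X(k)\in\mathcal{R}(\Omega,\mathcal{X})$, $U(k)\in\mathcal{R}(\Omega,\mathcal{U})$, and $W(k)\in\mathcal{R}(\Omega,\mathcal{W})$ i.i.d. with distribution $P_W$, $W(k)$ independent of $X(k)$ and $U(k)$. A control sequence $\mathbf{U}=(U(0),U(1),\ldots)$ is admissible if $\sigma(U(k))\subseteq\sigma(X(0),\ldots,X(k))$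 for all $k$; $\mathcal{U}^N(X_0)$ is the set of admissible control sequences of length $N$ for initial value $X_0$. Optimal control problem. $\ell(X,U):=\mathbb{E}[g(X,U)]$; minimize $J_N(X_0,\mathbf{U}):=\sum_{k=0}^{N-1}\ell(X(k),U(k))$ over $\mathbf{U}\in\mathcal{U}^N(X_0)$ subject to the system; $V_N(X_0)$ is the infimum and $\mathbf{U}^*_{N,X_0}$ denotes a minimizer (minimizers are assumed to exist whenever an algorithm uses them; they need not be unique). $\mathbb{X}$ is the set of states satisfying (read as the largest such set) $\mathbb{X}=\{X\in\mathcal{R}(\Omega,\mathcal{X})\mid\exists\,U\in\mathcal{R}(\Omega,\mathcal{U}):|\ell(X,U)|<\infty,\ f(X,U,W)\in\mathbb{X}\}$, where $W$ is a noise variable with law $P_W$ independent of $(X,U)$. Algorithm 1. For $j=0,1,\ldots$: set $X_0=X(j)\in\mathbb{X}$ (a random variable), solve the optimal control problem with horizon $N$ and this initial value, and apply the feedback $\mu_N(X(j)):=U^*_{N,X_0}(0)$ to the system to obtain $X(j+1)$. Algorithm 2. For $j=0,1,\ldots$: measure the realization $x_j:=X(j,\omega)\in\mathcal{X}$ and set $X_0\equiv x_j$ (a constant random variable), solve the optimal control problem with horizon $N$ and this initial value, and apply the feedback $\mu_N(x_j):=U^*_{N,x_j}(0)$ to the system. Thus a feedback law of Algorithm 2 is a map $\mathcal{X}\to\mathcal{U}$, selecting for each $x$ the first element of an optimal control sequence for the deterministic initial value $x$; ''measurable'' means this selection is measurable. It acts on random variables by composition, $\mu_N(X)(\omega)=\mu_N(X(\omega))$.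 Closed-loop cost. For a measurable feedback law $\mu:\mathcal{R}(\Omega,\mathcal{X})\to\mathcal{R}(\Omega,\mathcal{U})$, $X_\mu(\cdot,X_0)$ is the closed-loop solution $X_\mu(k+1,X_0)=f(X_\mu(k,X_0),\mu(X_\mu(k,X_0)),W(k))$, $X_\mu(0,X_0)=X_0$, and $J^{cl}_K(X_0,\mu):=\sum_{k=0}^{K-1}\ell(X_\mu(k,X_0),\mu(X_\mu(k,X_0)))$. *)

(* Defs.v *)
From HB Require Import structures.
From mathcomp Require Import all_boot all_order all_algebra.
From mathcomp Require Import all_classical all_reals all_analysis.

Set Implicit Arguments.
Unset Strict Implicit.
Unset Printing Implicit Defensive.

Import Order.TTheory GRing.Theory Num.Theory.
Import numFieldNormedType.Exports.

Local Open Scope classical_set_scope.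
Local Open Scope ring_scope.

(* The measurable space (S, B(S)) on the carrier of a topological space S. *)
Notation borel S := (g_sigma_algebraType (@open S)).

(* Homeomorphic to a Borel subset of a Polish space.  Complete pseudometric
   plus Hausdorff is complete metric; the third and fifth clauses say that h
   is a homeomorphism onto its range. *)
Definition borel_space (R : realType) (S : ptopologicalType) : Prop :=
  exists (Y : completePseudoMetricType R) (h : S -> Y),
    [/\ hausdorff_space Y,
        exists2 D : set Y, countable D & dense D,
        injective h,
        measurable (range h : set (borel Y)) &
        forall A : set S,
          open A <-> exists2 B : set Y, open B & A = h @^-1` B].

Section probability.
Context d (T : measurableType d) (R : realType) (P : probability T R).

Definition random_variables (S : ptopologicalType) : set (T -> S) :=
  [set X | measurable_fun [set: T] (X : T -> borel S)].

(* The sigma-algebra generated by the maps Y i, i in I. *)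
Definition sigma_of d' (S : measurableType d') (I : set nat)
    (Y : nat -> T -> S) : set (set T) :=
  <<s \bigcup_(i in I) preimage_set_system [set: T] (Y i) measurable >>.

Definition sigma_rv d' (S : measurableType d') (Y : T -> S) : set (set T) :=
  preimage_set_system [set: T] Y measurable.

Definition independent (F G : set (set T)) : Prop :=
  forall A B, F A -> G B -> P (A `&` B) = (P A * P B)%E.

Definition has_law (S : ptopologicalType) (X : T -> S)
    (Q : probability (borel S) R) : Prop :=
  forall A : set (borel S), measurable A ->
    pushforward P (X : T -> borel S) A = Q A.

(* The product rule over initial segments of indices gives it over every
   finite set of indices, since some of the B k may be the full space. *)
Definition iid (S : ptopologicalType) (W : nat -> T -> S)
    (Q : probability (borel S) R) : Prop :=
  [/\ forall k, random_variables (W k),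
      forall k, has_law (W k) Q &
      forall n (B : nat -> set (borel S)), (forall k, measurable (B k)) ->
        P (\bigcap_(k in `I_n) (W k @^-1` B k)) =
        (\prod_(k < n) P (W k @^-1` B k))%E].

End probability.
Arguments random_variables {d} T S.

Section control.
Context d (T : measurableType d) (R : realType) (P : probability T R).
Context (XX UU WW : ptopologicalType).
Context (f : XX * UU * WW -> XX) (g : XX * UU -> R).
Context (PW : probability (borel WW) R).

(* W may drive the system started in X0.  Independence of X0 from the whole
   sequence makes W k independent of X 0, ..., X k and of every control
   adapted to them. *)
Definition noise (X0 : T -> XX) (W : nat -> T -> WW) : Prop :=
  iid P W PW /\
  independent P (sigma_rv (X0 : T -> borel XX))
    (sigma_of [set: nat] (W : nat -> T -> borel WW)).

Fixpoint state (X0 : T -> XX) (W : nat -> T -> WW) (U : nat -> T -> UU)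
    (k : nat) : T -> XX :=
  if k is k'.+1 then
    fun w => f (state X0 W U k' w, U k' w, W k' w)
  else X0.

(* Control sequences of length N; entries from index N on are irrelevant. *)
Definition admissible (N : nat) (X0 : T -> XX) (W : nat -> T -> WW) :
    set (nat -> T -> UU) :=
  [set U | forall k, (k < N)%N ->
     random_variables T UU (U k) /\
     sigma_rv (U k : T -> borel UU) `<=`
       sigma_of `I_k.+1 (state X0 W U : nat -> T -> borel XX)].

(* Well defined in ]-oo, +oo] when g is bounded from below. *)
Definition stage_cost (X : T -> XX) (U : T -> UU) : \bar R :=
  ('E_P[fun w => g (X w, U w)])%E.

Definition cost (N : nat) (X0 : T -> XX) (W : nat -> T -> WW)
    (U : nat -> T -> UU) : \bar R :=
  (\sum_(k < N) stage_cost (state X0 W U k) (U k))%E.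

Definition value (N : nat) (X0 : T -> XX) (W : nat -> T -> WW) : \bar R :=
  ereal_inf [set cost N X0 W U | U in admissible N X0 W].

Definition minimizer (N : nat) (X0 : T -> XX) (W : nat -> T -> WW)
    (U : nat -> T -> UU) : Prop :=
  admissible N X0 W U /\ cost N X0 W U = value N X0 W.

Definition viable_step (S : set (T -> XX)) : set (T -> XX) :=
  [set X | random_variables T XX X /\
    exists (U : T -> UU) (W : T -> WW),
      [/\ random_variables T UU U,
          random_variables T WW W /\ has_law P W PW,
          independent P
            (sigma_rv ((fun w => (X w, U w)) : T -> (borel XX * borel UU)%type))
            (sigma_rv (W : T -> borel WW)),
          (`|stage_cost X U| < +oo)%E &
          S (fun w => f (X w, U w, W w))]].

(* viable_step is monotone, so the union of its fixed points is its largest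
   fixed point. *)
Definition viable : set (T -> XX) :=
  \bigcup_(S in [set S | S = viable_step S]) S.

(* Values outside random_variables T XX are irrelevant. *)
Definition measurable_feedback (mu : (T -> XX) -> T -> UU) : Prop :=
  forall X, random_variables T XX X ->
    random_variables T UU (mu X) /\
    sigma_rv (mu X : T -> borel UU) `<=` sigma_rv (X : T -> borel XX).

(* Feedback computed from the random variable X itself. *)
Definition stochastic_mpc_law (N : nat) (mu : (T -> XX) -> T -> UU) : Prop :=
  measurable_feedback mu /\
  forall X, viable X -> forall W, noise X W ->
    exists2 U, minimizer N X W U & U 0%N = mu X.

(* Feedback computed from a measured realization x of the state. *)
Definition pathwise_mpc_law (N : nat) (mu : XX -> UU) : Prop :=
  forall x W, noise (cst x) W ->
    exists2 U, minimizer N (cst x) W U & U 0%N = cst (mu x).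

Definition lift_law (mu : XX -> UU) : (T -> XX) -> T -> UU :=
  fun X => mu \o X.

(* mu1 X is a function phi of the state, and phi = mu2 almost surely with
   respect to the distribution of X. *)
Definition coincide_as (X : T -> XX) (mu1 : (T -> XX) -> T -> UU)
    (mu2 : XX -> UU) : Prop :=
  exists phi : XX -> UU,
    [/\ measurable_fun [set: borel XX] (phi : borel XX -> borel UU),
        mu1 X = phi \o X &
        {ae pushforward P (X : T -> borel XX), forall x, phi x = mu2 x}].

Fixpoint closed_loop (mu : (T -> XX) -> T -> UU) (X0 : T -> XX)
    (W : nat -> T -> WW) (k : nat) : T -> XX :=
  if k is k'.+1 then
    let X := closed_loop mu X0 W k' in fun w => f (X w, mu X w, W k' w)
  else X0.

Definition closed_loop_cost (K : nat) (X0 : T -> XX) (W : nat -> T -> WW)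
    (mu : (T -> XX) -> T -> UU) : \bar R :=
  (\sum_(k < K) stage_cost (closed_loop mu X0 W k)
                           (mu (closed_loop mu X0 W k)))%E.

End control.

(* Main.v *)
Require Import Defs.
From HB Require Import structures.
From mathcomp Require Import all_boot all_order all_algebra.
From mathcomp Require Import all_classical all_reals all_analysis.
From mathcomp Require Import measurable_realfun zify lra.
Import Order.TTheory GRing.Theory Num.Theory.
Import numFieldNormedType.Exports.
Local Open Scope classical_set_scope.
Local Open Scope ring_scope.
Set Implicit Arguments.
Unset Strict Implicit.
Unset Printing Implicit Defensive.

(** The feedback law [mu1] can be taken to be [mu2] acting by composition; the
    almost sure coincidence and the equality of closed-loop costs are then
    immediate.  What has to be proved is that, for every viable random state
    [X], the control [mu2 \o X] is the first control of an optimal sequence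
    for [X] ([pathwise_first_control]).

    Let [U*] be a minimizer for [X].  Its controls are functions of the
    observed states, so the same policy can be started from any deterministic
    state [x].  There it costs at least as much as the optimal sequence [U^x],
    whose first control is [mu2 x].  Suppose that the [U^x] depend measurably
    on [x].  Applying [U^x] on the event [X = x] then gives an admissible
    control sequence for [X] with first control [mu2 \o X].  As the noise is
    independent of [X], the cost of a policy started from [X] is the integral
    over the law of [X] of its costs from deterministic states
    ([independent_integral]), so the new sequence costs at most as much as
    [U*] and is optimal.

    It remains to choose the [U^x] measurably, and two tools serve this
    purpose.

    The first is a parametrization of policies by sequences of naturals.  A
    Borel space is a measurable retract of the space of such sequences
    ([borel_space_retract]), and an event of a countably generated
    sigma-algebra is, up to a null set, the eventual value of a sequence of
    Boolean combinations of the generators ([set_coding]).  Hence every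
    admissible sequence agrees almost surely with a policy given by a code
    ([admissible_coding]), and the cost of the policy with code [a] started
    from [x] is jointly measurable in [(x, a)].

    The second is a measurable selection theorem ([measurable_selection]),
    applied to the measurable set of pairs [(x, a)] for which the policy with
    first control [mu2 x] and code [a] costs, from [x], at most as much as
    [U*].  The pathwise minimizers show that each of its sections is nonempty.
    Comparing with [U*] instead of the value function keeps this set
    measurable: the value function, an infimum over uncountably many policies,
    need not be Borel.

    The selection theorem is proved as follows.  A measurable subset of
    [X * (nat -> nat)] is the projection of a set of pairs [(x, c)] defined by
    countably many constraints on [x], each triggered by finitely many values
    of [c] ([analytic_measurable]).  By continuity of the outer measure along
    increasing sequences, the sequence [c] can be bounded by a fixed sequence
    while losing an arbitrarily small mass of points [x] ([horn_bounds]).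
    Bounded sequences form a compact space, so the surviving [x] form a
    measurable set, on which the lexicographically least solution is a
    measurable function of [x] ([measurable_leftmost]). *)

(** * Least witnesses and measurable predicates *)

(** Total in [Q], with value [0] when no witness exists, so that it can be
    used under a quantifier over points without a side condition. *)
Definition least (Q : nat -> Prop) : nat :=
  xget 0%N [set k | Q k /\ forall j, (j < k)%N -> ~ Q j].

Lemma least_uniq (Q : nat -> Prop) k :
  Q k -> (forall j, (j < k)%N -> ~ Q j) -> least Q = k.
Proof.
move=> Qk km; rewrite /least; case: xgetP => [l _ [/= Ql lm]|/(_ k)[]]; last by [].
by have [/(km _)|/(lm _)|] := ltngtP l k.
Qed.

Lemma leastP (Q : nat -> Prop) :
  (exists k, Q k) -> Q (least Q) /\ forall j, (j < least Q)%N -> ~ Q j.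
Proof.
move=> [k Qk].
have [m [Qm mm]] : exists m, Q m /\ forall j, (j < m)%N -> ~ Q j.
  elim/ltn_ind: k Qk => k IH Qk.
  have [[j [jk Qj]]|nQ] := pselect (exists j, (j < k)%N /\ Q j); first exact: IH Qj.
  by exists k; split=> // j jk Qj; apply: nQ; exists j.
by rewrite (least_uniq Qm mm).
Qed.

Lemma least_none (Q : nat -> Prop) : ~ (exists k, Q k) -> least Q = 0%N.
Proof. by move=> nQ; apply: xgetPN => k [Qk _]; apply: nQ; exists k. Qed.

Section measurable_predicates.
Context d (M : measurableType d).

Lemma measurable_iff (A B : set M) :
  (forall x, A x <-> B x) -> measurable A -> measurable B.
Proof. by move=> AB; rewrite (_ : A = B)//; apply/seteqP; split=> x /AB. Qed.

Lemma measurable_forall (I : countType) (A : I -> set M) :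
  (forall i, measurable (A i)) -> measurable [set x | forall i, A i x].
Proof.
move=> mA; rewrite (_ : [set _ | _] = ~` \bigcup_i ~` A i).
  by apply/measurableC/countable_bigcupT_measurable => // i; exact/measurableC.
apply/seteqP; split=> x /=; first by move=> Ax [i _]; apply; exact: Ax.
by move=> nA i; apply: contrapT => nAi; apply: nA; exists i.
Qed.

Lemma measurable_exists (I : countType) (A : I -> set M) :
  (forall i, measurable (A i)) -> measurable [set x | exists i, A i x].
Proof.
move=> mA; rewrite (_ : [set _ | _] = \bigcup_i A i).
  exact: countable_bigcupT_measurable.
by apply/seteqP; split=> [x /= [i Ai]|x [i _ Ai]]; exists i.
Qed.

Lemma measurable_prop (Q : Prop) : measurable [set _ : M | Q].
Proof.
by have [q|nq] := pselect Q;
  [apply: (@measurable_iff setT)|apply: (@measurable_iff set0)].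
Qed.

Lemma measurable_imply (Q : Prop) (A : set M) :
  (Q -> measurable A) -> measurable [set x | Q -> A x].
Proof.
move=> mA; have [q|nq] := pselect Q.
  by apply: (@measurable_iff A); [move=> x /=; split=> [|/(_ q)]|exact: mA].
by apply: (@measurable_iff setT); [move=> x /=; split=> // _ /nq|exact: measurableT].
Qed.

Lemma measurable_and_prop (Q : Prop) (A : set M) :
  (Q -> measurable A) -> measurable [set x | Q /\ A x].
Proof.
move=> mA; have [q|nq] := pselect Q.
  by apply: (@measurable_iff A); [move=> x /=; split=> // -[]|exact: mA].
by apply: (@measurable_iff set0); [move=> x /=; split=> // -[]|exact: measurable0].
Qed.

Lemma measurable_least (Q : M -> nat -> Prop) m :
  (forall k, measurable [set x | Q x k]) ->
  measurable [set x | least (Q x) = m].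
Proof.
move=> mQ.
rewrite (_ : [set _ | _] =
   ([set x | Q x m] `&` [set x | forall j, (j < m)%N -> ~ Q x j]) `|`
   [set x | m = 0%N /\ forall k, ~ Q x k]); last first.
  apply/seteqP; split=> x /=.
    have [/leastP[]|nQ] := pselect (exists k, Q x k).
      by move=> ? ? <-; left.
    by rewrite least_none// => <-; right; split=> // k Qk; apply: nQ; exists k.
  move=> [[Qm mm]|[-> nQ]]; first exact: least_uniq.
  by rewrite least_none// => -[k /nQ].
apply: measurableU; first apply: measurableI => //.
  apply: measurable_forall => j; apply: measurable_imply => _.
  exact/measurableC/mQ.
apply: measurable_and_prop => _; apply: measurable_forall => j.
exact/measurableC/mQ.
Qed.

(** Measurability for the product sigma-algebra on sequences of naturals, in a
    form that does not require that type to carry a measurable structure. *)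
Definition measurable_coords (a : M -> nat -> nat) :=
  forall i k, measurable [set x | a x i = k].

Lemma measurable_coord (a : M -> nat -> nat) (i : nat) (S : nat -> Prop) :
  measurable_coords a -> measurable [set x | S (a x i)].
Proof.
move=> ma; rewrite (_ : [set _ | _] = [set x | exists k, S k /\ a x i = k]).
  apply: measurable_exists => k; apply: measurable_and_prop => _; exact: ma.
by apply/seteqP; split=> [x /= Sx|x /= [k [? ->//]]]; exists (a x i).
Qed.

Lemma measurable_coords_cst (a : nat -> nat) : measurable_coords (fun=> a).
Proof. by move=> i k; exact: measurable_prop. Qed.

End measurable_predicates.

Definition cylinders : set (set (nat -> nat)) :=
  [set A | exists i k, A = [set a | a i = k]].
Notation Baire := (g_sigma_algebraType cylinders).

Lemma measurable_coords_id : measurable_coords (fun a : Baire => (a : nat -> nat)).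
Proof. by move=> i k; apply: sub_sigma_algebra; exists i, k. Qed.

Lemma measurable_coords_comp d d' (M : measurableType d) (L : measurableType d')
    (h : M -> L) (a : L -> nat -> nat) :
  measurable_fun setT h -> measurable_coords a -> measurable_coords (a \o h).
Proof.
move=> mh ma i k; rewrite -[X in measurable X]setTI.
exact: (mh measurableT _ (ma i k)).
Qed.

Lemma measurable_fun_Baire d (M : measurableType d) (a : M -> Baire) :
  measurable_coords a -> measurable_fun setT a.
Proof.
move=> ma; apply: (@measurability _ _ _ Baire _ _ cylinders) => // A [B [i [k ->]] <-].
by rewrite setTI; exact: ma.
Qed.

(** * Projections of measurable sets along sequences of naturals *)

Section horn.
Context d (X : measurableType d).
Implicit Types K C : X -> (nat -> nat) -> Prop.

Definition matches (p : seq (nat * nat)) (c : nat -> nat) :=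
  all (fun ik => c ik.1 == ik.2) p.

(** The sets that play the role of closed sets: each constraint is a finite
    pattern on [c] that, when matched, forces [x] into a measurable set.  This
    clausal form makes stability under countable intersections and
    substitutions immediate, and only at the end is it turned into a tree. *)
Definition horn K := exists (p : nat -> seq (nat * nat)) (M : nat -> set X),
  (forall n, measurable (M n)) /\
  forall x c, K x c <-> forall n, matches (p n) c -> M n x.

Lemma horn_forall (K : nat -> X -> (nat -> nat) -> Prop) :
  (forall j, horn (K j)) -> horn (fun x c => forall j, K j x c).
Proof.
move=> /choice[p] /choice[M] KE.
pose q (n : nat) : option (nat * nat) := unpickle n.
exists (fun n => if q n is Some (j, i) then p j i else [::]),
  (fun n => if q n is Some (j, i) then M j i else setT); split.
  by move=> n; case: (q n) => [[j i]|//]; exact: (KE j).1.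
move=> x c; split=> [Kx n|Kx j].
  by case: (q n) => [[j i]|//]; apply: ((KE j).2 x c).1.
by apply/(KE j).2 => i; have := Kx (pickle (j, i)); rewrite /q pickleK.
Qed.

Lemma horn_subst (e : nat -> nat) K :
  horn K -> horn (fun x c => K x (c \o e)).
Proof.
move=> [p [M [mM KE]]].
exists (fun n => [seq (e ik.1, ik.2) | ik <- p n]), M; split=> // x c.
rewrite KE; split=> H n; have := H n; rewrite /matches all_map; exact.
Qed.

Lemma horn_imply i k K : horn K -> horn (fun x c => c i = k -> K x c).
Proof.
move=> [p [M [mM KE]]]; exists (fun n => (i, k) :: p n), M; split=> // x c.
split=> [H n /= /andP[/eqP cik] |H cik]; first by move: n; apply/KE/H.
by apply/KE => n mt; apply: H; rewrite /= cik eqxx.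
Qed.

Lemma horn_cst (A : set X) : measurable A -> horn (fun x _ => A x).
Proof.
move=> mA; exists (fun _ => [::]), (fun _ => A); split=> // x c.
by split=> [//|/(_ 0%N)]; apply.
Qed.

Lemma horn_neq i k : horn (fun _ c => c i <> k).
Proof. exact: (horn_imply i k (horn_cst measurable0)). Qed.

(** A value is fixed by excluding all the others: constraints can only
    exclude. *)
Lemma horn_eq i k : horn (fun _ c => c i = k).
Proof.
have := @horn_forall (fun j x c => if j == k then setT x else c i <> j).
case=> [j|p [M [mM KE]]].
  by case: eqP => _; [exact: horn_cst|exact: horn_neq].
exists p, M; split=> // x c; rewrite -KE; split=> [<- j|/(_ (c i))].
  by case: eqP => // + cij; rewrite cij.
by case: eqP.
Qed.

Definition interleave (a b : nat -> nat) n := if odd n then b n./2 else a n./2.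

(** Projections of the previous sets along an auxiliary sequence [b]. *)
Definition analytic C := exists K, horn K /\
  forall x a, C x a <-> exists b, K x (interleave a b).

Lemma analytic_horn K : horn K -> analytic K.
Proof.
move=> /(horn_subst double) hK; eexists; split; first exact: hK.
move=> x a.
have iE b : interleave a b \o double = a.
  by apply/funext => n; rewrite /interleave /= odd_double doubleK.
by split=> [Kx|[b]]; [exists a|]; rewrite iE.
Qed.

(** The auxiliary sequences of all the [C j] are packed into one. *)
Lemma analytic_forall (C : nat -> X -> (nat -> nat) -> Prop) :
  (forall j, analytic (C j)) -> analytic (fun x a => forall j, C j x a).
Proof.
move=> /choice[K] KE.
pose e (j n : nat) := if odd n then (pickle (j, n./2)).*2.+1 else n.
have eE j a b : interleave a b \o e j =
    interleave a (fun n => b (pickle (j, n))).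
  apply/funext => n; rewrite /interleave /e /=; case on: (odd n); last by rewrite on.
  by rewrite /= odd_double /= uphalf_double.
exists (fun x c => forall j, K j x (c \o e j)); split.
  by apply: horn_forall => j; apply: horn_subst; exact: (KE j).1.
move=> x a; split=> [Cx|[b Kb] j]; last first.
  by apply/(KE j).2; have := Kb j; rewrite eE => ?; eexists; eassumption.
have /choice[b bK] j : exists b, K j x (interleave a b) by apply/(KE j).2.
exists (fun n => if unpickle n is Some ji then b ji.1 ji.2 else 0%N) => j.
rewrite eE; rewrite (_ : (fun n => _) = b j) //.
by apply/funext => n; rewrite pickleK.
Qed.

(** The index [j] becomes the first entry of the auxiliary sequence. *)
Lemma analytic_exists (C : nat -> X -> (nat -> nat) -> Prop) :
  (forall j, analytic (C j)) -> analytic (fun x a => exists j, C j x a).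
Proof.
move=> /choice[K] KE.
(* [e] skips the first entry of the auxiliary sequence *)
pose e n := if odd n then n.+2 else n.
have eE a b : interleave a b \o e = interleave a (b \o S).
  apply/funext => n; rewrite /interleave /e /=.
  by case on: (odd n) => /=; rewrite ?negbK on.
exists (fun x c => forall j, c 1%N = j -> K j x (c \o e)); split.
  apply: horn_forall => j; apply: horn_imply; apply: horn_subst.
  exact: (KE j).1.
move=> x a; split=> [[j Cj]|[b]].
  have [b Kb] := ((KE j).2 x a).1 Cj.
  by exists (fun n => if n is m.+1 then b m else j) => i <-; rewrite eE.
move=> /(_ _ erefl); rewrite eE => Kb.
by exists (b 0%N); apply/(KE _).2; exists (b \o S).
Qed.

(** Sets that are analytic together with their complement form a
    sigma-algebra, and it contains the generators of the product. *)
Lemma analytic_measurable (C : set (X * Baire)) :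
  measurable C -> analytic (fun x a => C (x, a)).
Proof.
pose G := [set C : set (X * Baire) | analytic (fun x a => C (x, a)) /\
                               analytic (fun x a => ~ C (x, a))].
suff sG : g_sigma_preimageU fst snd `<=` G by move=> /sG[].
have G0 : G set0.
  split; first exact/analytic_horn/(horn_cst measurable0).
  have := analytic_horn (horn_cst (@measurableT _ X)).
  move=> [K [hK KE]]; exists K; split=> // x a; rewrite -KE; split=> // _ [].
have GC A : G A -> G (~` A).
  move=> [GA [K [hK KE]]]; split; first by exists K.
  move: GA => [L [hL LE]]; exists L; split=> // x a; rewrite -LE.
  by split=> [/contrapT|Ax]; last exact.
have GU (F : nat -> set (X * Baire)) : (forall i, G (F i)) -> G (\bigcup_i F i).
  move=> GF; split.
    have [K [hK KE]] := analytic_exists (fun i => (GF i).1).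
    exists K; split=> // x a; rewrite -KE.
    by split=> [[i _ ?]|[i ?]]; exists i.
  have [K [hK KE]] := analytic_forall (fun i => (GF i).2).
  exists K; split=> // x a; rewrite -KE; split=> [nF j Fj|nF [j _]].
    by apply: nF; exists j.
  exact: nF.
have sG : sigma_algebra setT G by split=> // A; rewrite setTD; exact: GC.
apply: smallest_sub => // _ [[A mA <-]|[A mA <-]]; rewrite setTI.
  split; apply: analytic_horn; first exact: (horn_cst mA).
  exact: (horn_cst (measurableC mA)).
have sG' : sigma_algebra setT [set A : set (nat -> nat) | G (snd @^-1` A)].
  split=> [|B /= GB|F GF] /=.
  - by rewrite preimage_set0.
  - by rewrite setTD preimage_setC; exact: GC.
  - by rewrite preimage_bigcup; exact: GU.
move: A mA; apply: smallest_sub => // _ [i [k ->]] /=.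
by split; apply: analytic_horn; [exact: horn_eq|exact: horn_neq].
Qed.

(** A sequence [c] satisfies all constraints if and only if each of its
    prefixes [t] passes the finite test [A t], which checks the constraints
    whose rank and pattern are bounded by the length of [t]. *)
Lemma horn_tree K : horn K -> exists A : seq nat -> set X,
  [/\ forall t, measurable (A t),
      forall x c, K x c <-> forall n, A (mkseq c n) x &
      forall t r, A (t ++ r) `<=` A t].
Proof.
move=> [p [M [mM KE]]].
pose A t := [set x | forall m, (m < size t)%N /\ 
  all (fun ik => ik.1 < size t)%N (p m) /\ matches (p m) (nth 0%N t) -> M m x].
exists A; split.
- by move=> t; apply: measurable_forall => m; apply: measurable_imply => _.
- move=> x c; rewrite KE; split=> [H n m [_ [ps pm]]|H m mt].
    apply: H; apply/allP => ik ikp; move/allP: pm => /(_ _ ikp).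
    by rewrite nth_mkseq//; move/allP: ps => /(_ _ ikp); rewrite size_mkseq.
  have [n [mn pn]] : exists n, (m < n)%N /\ all (fun ik => ik.1 < n)%N (p m).
    exists (maxn m (\max_(ik <- p m) ik.1)).+1; split; first by lia.
    apply/allP => ik ikp; rewrite ltnS leq_max; apply/orP; right.
    exact: (@leq_bigmax_seq _ _ predT (fun ik : nat * nat => ik.1)).
  apply: (H n m); rewrite size_mkseq; split=> //; split=> //.
  apply/allP => ik ikp; rewrite nth_mkseq; last by move/allP: pn; exact.
  by move/allP: mt; exact.
- move=> t r x Ax m [mt [ps pm]]; apply: Ax; rewrite size_cat; split; first by lia.
  split; first by apply: sub_all ps => ik; lia.
  apply/allP => ik ikp; rewrite nth_cat.
  by move/allP: ps => -> //; move/allP: pm; exact.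
Qed.
End horn.

(** * Measurable selection almost everywhere *)

Section leftmost_branch.
Context d (X : measurableType d) (A : seq nat -> set X) (b : nat -> nat).
Hypothesis mA : forall t, measurable (A t).
Hypothesis A_cat : forall t r, A (t ++ r) `<=` A t.

(** The prefix [t] has extensions of every length that are bounded by [b] and
    pass the tests [A].  Finitely many sequences of each length are bounded,
    hence this condition, which is measurable in [x], is equivalent to the
    existence of an infinite solution: this is Koenig's lemma. *)
Definition alive (t : seq nat) : set X := [set x | forall n, exists r,
  [/\ size r = n, (forall i, (i < n)%N -> (nth 0%N r i <= b (size t + i))%N)
    & A (t ++ r) x]].

Let measurable_alive t : measurable (alive t).
Proof.
apply: measurable_forall => n /=.
apply: (@measurable_iff _ _ [set x | exists r, (size r = n /\
   (forall i, (i < n)%N -> (nth 0%N r i <= b (size t + i))%N)) /\ A (t ++ r) x]).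
  by move=> x; split=> -[r]; [move=> [[? ?] ?]|move=> [? ? ?]]; exists r.
by apply: measurable_exists => r; apply: measurable_and_prop.
Qed.

(** If every bounded child [j] dies at some depth [n j], then [t] dies at the
    maximum of these finitely many depths. *)
Lemma alive_rcons t x : alive t x -> exists j, alive (rcons t j) x.
Proof.
move=> tx; apply: contrapT => dead.
have /choice[n nP] : forall j, exists n, forall r, size r = n ->
    (forall i, (i < n)%N -> (nth 0%N r i <= b ((size t).+1 + i))%N) ->
    ~ A (rcons t j ++ r) x.
  move=> j; apply: contrapT => nj; apply: dead; exists j => n.
  apply: contrapT => H; apply: nj; exists n => r rn rb Ar; apply: H.
  by exists r; split=> // i; rewrite size_rcons; exact: rb.
have [[|j r] [// [rn] rb Ar]] := tx (\max_(j < (b (size t)).+1) n j).+1.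
have jb : (j < (b (size t)).+1)%N by have := rb 0%N; rewrite /= addn0; apply.
have nr : (n j <= size r)%N by rewrite rn (leq_bigmax (Ordinal jb)).
move: Ar; rewrite -cat_rcons -(cat_take_drop (n j) r) catA => /A_cat.
apply: nP; first by rewrite size_takel.
move=> i ij; rewrite nth_take// addSnnS; have := rb i.+1.
by rewrite /=; apply; rewrite ltnS -rn (leq_trans ij).
Qed.

Fixpoint branch (n : nat) (x : X) : seq nat :=
  if n is m.+1 then
    rcons (branch m x) (least (fun j => alive (rcons (branch m x) j) x))
  else [::].

Definition leftmost (x : X) (n : nat) : nat :=
  least (fun j => alive (rcons (branch n x) j) x).

Lemma branchE x n : branch n x = mkseq (leftmost x) n.
Proof.
elim: n => [//|n IH] /=; rewrite -/(leftmost x n) IH.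
by rewrite /mkseq -addn1 iotaD map_cat cats1.
Qed.

Lemma leftmost_alive x : alive [::] x -> forall n, A (mkseq (leftmost x) n) x.
Proof.
move=> x0 n; rewrite -branchE.
have : alive (branch n x) x.
  elim: n => [//|n IH] /=.
  by have [] := leastP (alive_rcons IH).
by move=> /(_ 0%N)[r [/size0nil -> _]]; rewrite cats0.
Qed.

Lemma measurable_leftmost : measurable_coords leftmost.
Proof.
have ml t m : measurable [set x | least (fun j => alive (rcons t j) x) = m].
  by apply: measurable_least => k; exact: measurable_alive.
have mB n t : measurable [set x | branch n x = t].
  elim: n t => [|n IH] t /=.
    exact: measurable_prop.
  rewrite (_ : [set _ | _] = [set x | exists u, [set x | branch n x = u] x /\
     (exists m, rcons u m = t /\ least (fun j => alive (rcons u j) x) = m)]).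
    apply: measurable_exists => u; apply: measurableI => //.
    apply: measurable_exists => m; apply: measurable_and_prop => _; exact: ml.
  apply/seteqP; split=> x /=; first by move=> <-; eexists; split=> //; eexists.
  by move=> [u [<- [m [<- ->]]]].
move=> n k; rewrite (_ : [set _ | _] = [set x | exists u,
    [set x | branch n x = u] x /\ least (fun j => alive (rcons u j) x) = k]).
  apply: measurable_exists => u; apply: measurableI; [exact: mB|exact: ml].
apply/seteqP; split=> x /=; first by move=> <-; eexists; split.
by move=> [u [<- <-]].
Qed.

Lemma measurable_alive_nil : measurable (alive [::]).
Proof. exact: measurable_alive. Qed.

End leftmost_branch.

Section outer_mass.
Context d (X : measurableType d) (R : realType) (nu : probability X R).
Local Open Scope ereal_scope.

(** The outer measure of [A], a set that need not be measurable, exceeds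
    [r].  Keeping an intermediate [r'] in the definition lets the same [r]
    survive infinitely many applications of the next lemma. *)
Definition outer_mass_gt (r : R) (A : set X) := exists2 r' : R, (r < r')%R &
  forall B, measurable B -> A `<=` B -> r'%:E <= nu B.

(** Continuity of the outer measure along increasing sequences of arbitrary
    sets: if every [A n] had a measurable cover of measure at most [s < r'],
    the inferior limit of these covers would cover the union. *)
Lemma outer_mass_gt_bigcup r (A : nat -> set X) :
  {homo A : m n / (m <= n)%N >-> m `<=` n} ->
  outer_mass_gt r (\bigcup_n A n) -> exists n, outer_mass_gt r (A n).
Proof.
move=> Ah [r' rr' Ar']; apply: contrapT => An.
pose s := ((r + r') / 2)%R.
have rs : (r < s)%R by rewrite /s; lra.
have sr' : (s < r')%R by rewrite /s; lra.
have /choice[B BP] n : exists B, [/\ measurable B, A n `<=` B & nu B <= s%:E].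
  apply: contrapT => nB; apply: An; exists n; exists s => // B mB AB.
  have [//|/ltW Bs] := leP (s%:E) (nu B).
  by exfalso; apply: nB; exists B.
pose C n := \bigcap_(i in [set i | (n <= i)%N]) B i.
have mB n : measurable (B n) by have [] := BP n.
have mC n : measurable (C n).
  by apply: bigcap_measurableType => k _; exact: mB.
have AC : \bigcup_n A n `<=` \bigcup_n C n.
  move=> x [n _ Ax]; exists n => // i /= ni; have [_ + _] := BP i; apply.
  exact: Ah Ax.
have mCU : measurable (\bigcup_n C n) by exact: bigcup_measurable.
have ndC : nondecreasing_seq C.
  move=> m n mn; apply/subsetPset => x Cx i /= ni; apply: Cx => /=.
  exact: leq_trans ni.
have cvC := @nondecreasing_cvg_mu _ _ _ nu _ mC mCU ndC.
have : nu (\bigcup_n C n) <= s%:E.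
  rewrite -(cvg_lim _ cvC)//; apply: lime_le; first by apply/cvg_ex; eexists; exact: cvC.
  apply: nearW => n /=; have [_ _ +] := BP n; apply: le_trans.
  by apply: le_measure; rewrite ?inE//; apply: bigcap_inf => /=.
move=> /(le_trans (Ar' _ mCU AC)); rewrite lee_fin; apply/negP.
by rewrite -ltNge.
Qed.

End outer_mass.

Section measurable_selection.
Context d (X : measurableType d) (R : realType) (nu : probability X R).
Local Open Scope ereal_scope.

Definition dominated (b : seq nat) (c : nat -> nat) :=
  forall i, (i < size b)%N -> (c i <= nth 0%N b i)%N.

(** The bounds are chosen one coordinate after the other.  The sets of points
    having a solution below [t] extended by [j] increase with [j] to the set of
    points having a solution below [t]. *)
Lemma horn_bounds (K : X -> (nat -> nat) -> Prop) (r : R) :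
  (r < 1)%R -> (forall x, exists c, K x c) ->
  exists b : nat -> nat, forall n,
    outer_mass_gt nu r [set x | exists2 c, K x c & dominated (mkseq b n) c].
Proof.
move=> r1 Kx.
pose good (t : seq nat) := outer_mass_gt nu r
  [set x | exists2 c, K x c & dominated t c].
have good0 : good [::].
  exists 1%R => // B mB sB.
  rewrite (_ : B = setT) ?probability_setT//; apply/seteqP; split=> // x _.
  by apply: sB; have [c Kc] := Kx x; exists c.
have goodS t : good t -> exists j, good (rcons t j).
  move=> gt; apply: outer_mass_gt_bigcup.
    move=> m n mn x [c Kc cd]; exists c => // i.
    rewrite size_rcons nth_rcons => it; have := cd i.
    rewrite size_rcons nth_rcons => /(_ it).
    case: ifP => // _; case: ifP => // _ /leq_trans; exact.
  move: gt => [r' rr' H]; exists r' => // B mB sB; apply: H => // x [c Kc cd].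
  apply: sB; exists (c (size t)) => //; exists c => // i.
  rewrite size_rcons nth_rcons => it; case: ifP => [/cd//|si].
  by case: eqP => [->//|]; lia.
have /choice[nxt nxtP] : forall t, exists j, good t -> good (rcons t j).
  move=> t; have [/goodS[j gj]|ng] := pselect (good t); first by exists j.
  by exists 0%N.
pose br := fix br n := if n is m.+1 then rcons (br m) (nxt (br m)) else [::].
exists (fun n => nxt (br n)) => n.
rewrite (_ : mkseq _ n = br n); last first.
  elim: n => [//|n IH] /=; rewrite -IH.
  by rewrite /mkseq -addn1 iotaD map_cat cats1 -/(mkseq _ _) IH.
rewrite -/(good _); elim: n => [//|n] /=; exact: nxtP.
Qed.

(** The points alive at the root form an intersection of decreasing
    measurable sets, each of which contains a set of outer measure larger than
    [r]. *)
Lemma selection_gt (K : X -> (nat -> nat) -> Prop) (r : R) :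
  (r < 1)%R -> horn K -> (forall x, exists c, K x c) ->
  exists E s, [/\ measurable E, r%:E <= nu E, measurable_coords s
    & forall x, E x -> K x (s x)].
Proof.
move=> r1 /horn_tree[A [mA KA A_cat]] /(horn_bounds r1)[b bP].
exists (alive A b [::]), (leftmost A b); split.
- exact: measurable_alive_nil.
- pose L n := [set x | exists t, [/\ size t = n,
    (forall i, (i < n)%N -> (nth 0%N t i <= b i)%N) & A t x]].
  have LE : alive A b [::] = \bigcap_n L n.
    by apply/seteqP; split=> [x Ax n _|x Lx n]; [exact: Ax|exact: Lx].
  have mL n : measurable (L n).
    rewrite (_ : L n = [set x | exists t, (size t = n /\
      forall i, (i < n)%N -> (nth 0%N t i <= b i)%N) /\ A t x]).
      by apply: measurable_exists => t; apply: measurable_and_prop.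
    by apply/seteqP; split=> x [t]; [move=> [? ? ?]|move=> [[? ?] ?]]; exists t.
  have niL : nonincreasing_seq L.
    move=> m n mn; apply/subsetPset => x [t [tn tb At]].
    exists (take m t); split.
    + by rewrite size_takel// tn.
    + by move=> i im; rewrite nth_take//; apply: tb; exact: leq_trans im mn.
    + by apply: (A_cat _ (drop m t)); rewrite cat_take_drop.
  have mLI : measurable (\bigcap_n L n) by exact: bigcap_measurableType.
  have L0 : nu (L 0%N) < +oo by rewrite ltey_eq fin_num_measure.
  have cvL := @nonincreasing_cvg_mu _ _ _ nu _ L0 mL mLI niL.
  rewrite LE -(cvg_lim _ cvL)//; apply: lime_ge.
    by apply/cvg_ex; eexists; exact: cvL.
  apply: nearW => n /=; have [r' /ltW rr'] := bP n.
  move=> /(_ _ (mL n)) H; apply: le_trans (H _); first by rewrite lee_fin.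
  move=> x [c /KA Kc cd]; exists (mkseq c n); split=> //.
    by rewrite size_mkseq.
  move=> i i_n; rewrite nth_mkseq//; have := cd i.
  by rewrite size_mkseq nth_mkseq//; apply.
- exact: measurable_leftmost.
- by move=> x Ex; apply/KA => n; exact: leftmost_alive.
Qed.

(** A selector exists outside sets of arbitrarily small measure; on the union
    of their complements, which has full measure, the first one available is
    used. *)
Theorem measurable_selection (C : set (X * Baire)) :
  measurable C -> (forall x, exists a, C (x, a)) ->
  exists2 s : X -> nat -> nat, measurable_coords s &
    {ae nu, forall x, C (x, s x)}.
Proof.
move=> /analytic_measurable[K [hK KC]] Cx.
have Kx x : exists c, K x c.
  by have [a /KC[b Kb]] := Cx x; exists (interleave a b).
have /choice[E /choice[s EsP]] : forall m : nat, exists E s,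
    [/\ measurable E, (1 - m.+1%:R^-1)%:E <= nu E, measurable_coords s
      & forall x, E x -> K x (s x)].
  by move=> m; apply: selection_gt => //; rewrite ltrBlDr ltrDl invr_gt0.
have mE m : measurable (E m) by have [] := EsP m.
pose sel x := s (least (fun m => E m x)) x.
(* the even entries of a solution are the point itself, the odd ones the
   auxiliary sequence *)
exists (fun x i => sel x i.*2).
  move=> i k; rewrite (_ : [set _ | _] = [set x | exists m,
      [set x | least (fun m => E m x) = m] x /\ s m x i.*2 = k]).
    apply: measurable_exists => m; apply: measurableI.
      by apply: measurable_least => j; exact: mE.
    by have [_ _ + _] := EsP m; exact.
  apply/seteqP; split=> x /=; first by move=> <-; eexists; split.
  by move=> [m [<- <-]].
exists (~` \bigcup_m E m); split.
- by apply/measurableC/bigcup_measurable => m _; exact: mE.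
- rewrite -[LHS]/(nu _) probability_setC; last exact: bigcup_measurable.
  suff -> : nu (\bigcup_m E m) = 1 by rewrite subee.
  apply/eqP; rewrite eq_le probability_le1/=; last exact: bigcup_measurable.
  apply/lee_addgt0Pr => e e0; rewrite -leeBlDr//.
  have [m me] : exists m : nat, (m.+1%:R^-1 < e)%R.
    exists (Num.truncn e^-1); rewrite invf_plt ?posrE//; exact: truncnS_gt.
  have [_ + _ _] := EsP m => Em; apply: (@le_trans _ _ (nu (E m))).
    by apply: le_trans Em; rewrite -EFinB lee_fin lerB// ltW.
  apply: le_measure; rewrite ?inE//; first exact: bigcup_measurable.
  exact: bigcup_sup.
- move=> x /= nC [m _ Em]; apply: nC.
  have [Ex _] := @leastP (fun m => E m x) (ex_intro _ m Em).
  have [_ _ _ /(_ x Ex) Kx'] := EsP (least (fun m => E m x)).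
  apply/KC; exists (fun n => sel x n.*2.+1).
  rewrite (_ : interleave _ _ = sel x)//.
  apply/funext => n; rewrite /interleave; have := odd_double_half n.
  by case: (odd n) => [|] <-; rewrite ?add0n ?add1n /= ?uphalf_double ?doubleK.
Qed.

End measurable_selection.

(** * Coding measurable functions by sequences of naturals *)

(** Boolean combinations of countably many events.  They form a countable
    algebra, which is what allows their enumeration by naturals. *)
Inductive bform := Atom of nat | Nand of bform & bform.

Fixpoint beval (z : nat -> bool) (t : bform) : bool :=
  match t with Atom n => z n | Nand t u => ~~ (beval z t && beval z u) end.

Fixpoint tree_of_bform (t : bform) : GenTree.tree nat :=
  match t with
  | Atom n => GenTree.Leaf n
  | Nand t u => GenTree.Node 0 [:: tree_of_bform t; tree_of_bform u]
  end.

Fixpoint bform_of_tree (t : GenTree.tree nat) : bform :=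
  match t with
  | GenTree.Leaf n => Atom n
  | GenTree.Node _ [:: t; u] => Nand (bform_of_tree t) (bform_of_tree u)
  | _ => Atom 0
  end.

Lemma tree_of_bformK : cancel tree_of_bform bform_of_tree.
Proof. by elim=> [//|t IHt u IHu] /=; rewrite IHt IHu. Qed.

Definition bform_code (t : bform) : nat := pickle (tree_of_bform t).

Definition bform_decode (n : nat) : bform :=
  bform_of_tree (odflt (GenTree.Leaf 0%N) (unpickle n)).

Lemma bform_codeK : cancel bform_code bform_decode.
Proof. by move=> t; rewrite /bform_decode pickleK /= tree_of_bformK. Qed.

(** A code [a] enumerates Boolean combinations and stands for their inferior
    limit; [z] lists which of the basic events occur. *)
Definition eventually_true (z : nat -> bool) (a : nat -> nat) : Prop :=
  exists n0, forall n, (n0 <= n)%N -> beval z (bform_decode (a n)).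

(** A function with values in sequences of naturals is determined by its level
    sets, one for each coordinate [i] and value [k]; their codes are stored
    side by side in a single sequence. *)
Definition decode (z : nat -> bool) (a : nat -> nat) (i : nat) : nat :=
  least (fun k => eventually_true z (fun n => a (pickle (i, k, n)))).

Definition measurable_bits d (M : measurableType d) (z : M -> nat -> bool) :=
  forall n, measurable [set x | z x n].

Section measurable_decode.
Context d (M : measurableType d) (z : M -> nat -> bool) (a : M -> nat -> nat).
Hypotheses (mz : measurable_bits z) (ma : measurable_coords a).

Lemma measurable_beval t : measurable [set x | beval (z x) t].
Proof.
elim: t => [n|t IHt u IHu] /=; first exact: mz.
apply: (@measurable_iff _ _ (~` ([set x | beval (z x) t] `&` [set x | beval (z x) u]))).
  by move=> x /=; case: (beval (z x) t); case: (beval (z x) u) => /=; intuition.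
exact/measurableC/measurableI.
Qed.

Lemma measurable_decode : measurable_coords (fun x => decode (z x) (a x)).
Proof.
move=> i m; apply: measurable_least => k.
apply: measurable_exists => n0; apply: measurable_forall => n.
apply: measurable_imply => _.
apply: (@measurable_iff _ _ [set x | exists j,
  [set x | a x (pickle (i, k, n)) = j] x /\ beval (z x) (bform_decode j)]).
  by move=> x; split=> [[j [/= -> //]]|H]; exists (a x (pickle (i, k, n))).
apply: measurable_exists => j; apply: measurableI; first exact: ma.
exact: measurable_beval.
Qed.

End measurable_decode.

Section coding.
Context d (T : measurableType d) (R : realType) (P : probability T R).
Context (z : T -> nat -> bool).
Hypothesis mz : measurable_bits z.
Local Open Scope ereal_scope.

Let sd (A B : set T) := (A `\` B) `|` (B `\` A).

Let msd A B : measurable A -> measurable B -> measurable (sd A B).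
Proof. by move=> mA mB; apply: measurableU; exact: measurableD. Qed.

Let bset (t : bform) := [set w | beval (z w) t].

Let mbset t : measurable (bset t). Proof. exact: measurable_beval. Qed.

Let bset_Nand t u : bset (Nand t u) = ~` (bset t `&` bset u).
Proof.
apply/seteqP; rewrite /bset; split=> w /=;
by case: (beval (z w) t); case: (beval (z w) u) => /=; intuition.
Qed.

Let bset_Nandid t : bset (Nand t t) = ~` bset t.
Proof. by rewrite bset_Nand setIid. Qed.

Definition approximable (A : set T) := measurable A /\
  forall e : R, (0 < e)%R -> exists t, P (sd A (bset t)) < e%:E.

Let sd_le (A B C D E F : set T) (e : R) :
  measurable A -> measurable B -> measurable C -> measurable D ->
  measurable E -> measurable F ->
  sd E F `<=` sd A B `|` sd C D -> (0 < e)%R ->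
  P (sd A B) < (e / 2)%:E -> P (sd C D) < (e / 2)%:E ->
  P (sd E F) < e%:E.
Proof.
move=> mA mB mC mD mE mF sub e0 AB CD.
apply: (@le_lt_trans _ _ (P (sd A B `|` sd C D))).
  apply: le_measure; rewrite ?inE//; first exact: msd.
  by apply: measurableU; exact: msd.
apply: (@le_lt_trans _ _ (P (sd A B) + P (sd C D))).
  by apply: measureU2; exact: msd.
by rewrite (splitr e) EFinD lteD.
Qed.

Let approx_setC A : approximable A -> approximable (~` A).
Proof.
move=> [mA Ae]; split; first exact: measurableC.
move=> e /Ae[t te]; exists (Nand t t); congr (P _ < _): te.
by rewrite bset_Nandid /sd !setDE !setCK setUC (setIC A) (setIC (bset t)).
Qed.

Let approx_setU A B : approximable A -> approximable B -> approximable (A `|` B).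
Proof.
move=> [mA Ae] [mB Be]; split; first exact: measurableU.
move=> e e0; have e20 : (0 < e / 2)%R by rewrite divr_gt0.
have [t te] := Ae _ e20; have [u ue] := Be _ e20.
exists (Nand (Nand t t) (Nand u u)).
apply: (sd_le _ _ _ _ _ _ _ e0 te ue) => //; first exact: measurableU.
rewrite bset_Nand !bset_Nandid -setCU setCK /sd => w /=.
by have [|] := pselect (A w); have [|] := pselect (B w); tauto.
Qed.

Let approx_set0 : approximable set0.
Proof.
split=> // e e0.
(* the negation of an instance of the excluded middle *)
exists (Nand (Nand (Atom 0) (Nand (Atom 0) (Atom 0)))
  (Nand (Atom 0) (Nand (Atom 0) (Atom 0)))).
rewrite bset_Nandid bset_Nand bset_Nandid setICr setC0 setCT.
by rewrite /sd setDv setU0 measure0 lte_fin.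
Qed.

Let approx_bigcup (F : nat -> set T) :
  (forall n, approximable (F n)) -> approximable (\bigcup_n F n).
Proof.
move=> Fa; have mF n : measurable (F n) by case: (Fa n).
pose U n := \big[setU/set0]_(i < n) F i.
have mU n : measurable (U n) by apply: bigsetU_measurable.
have Ua n : approximable (U n).
  rewrite /U; elim: n => [|n IH]; first by rewrite big_ord0.
  by rewrite big_ord_recr; exact: approx_setU.
have mB : measurable (\bigcup_n F n) by exact: bigcup_measurable.
split=> // e e0; have e20 : (0 < e / 2)%R by rewrite divr_gt0.
pose D n := \bigcup_n F n `\` U n.
have mD n : measurable (D n) by exact: measurableD.
have [n Dn] : exists n, P (D n) < (e / 2)%:E.
  apply: contrapT => nD.
  have D0 : P (D 0%N) < +oo by rewrite ltey_eq fin_num_measure.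
  have mI : measurable (\bigcap_n D n) by exact: bigcap_measurableType.
  have niD : nonincreasing_seq D.
    move=> m n mn; apply/subsetPset; apply: setDS.
    exact: subset_bigsetU.
  have cvD := @nonincreasing_cvg_mu _ _ _ P _ D0 mD mI niD.
  have : (e / 2)%:E <= P (\bigcap_n D n).
    rewrite -(cvg_lim _ cvD)//; apply: lime_ge.
      by apply/cvg_ex; eexists; exact: cvD.
    apply: nearW => n /=; rewrite leNgt; apply/negP => Dn; apply: nD.
    by exists n.
  rewrite (_ : \bigcap_n D n = set0) ?measure0 ?lee_fin ?leNgt ?e20//.
  apply/seteqP; split=> // w Dw; have [[n _ Fn] _] := Dw 0%N I.
  have [_] := Dw n.+1 I; apply; rewrite /U big_ord_recr; by right.
have [t te] := (Ua n).2 _ e20; exists t.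
apply: (@sd_le (U n) (bset t) (\bigcup_n F n) (U n)) => //.
  rewrite /sd => w /=; have [|] := pselect (U n w);
  have [|] := pselect ((\bigcup_n F n) w); tauto.
rewrite (_ : sd _ _ = D n)//; rewrite /sd (_ : U n `\` _ = set0) ?setU0//.
rewrite setD_eq0 /U => w /=; rewrite -bigcup_mkord => -[i _ Fi]; by exists i.
Qed.

(** Approximable events form a sigma-algebra that contains the basic
    ones. *)
Lemma approximable_sigma A :
  <<s [set A | exists n, A = [set w | z w n]] >> A -> approximable A.
Proof.
move: A; apply: smallest_sub.
  by split=> // A; rewrite setTD; exact: approx_setC.
move=> _ [n ->]; split=> // e e0; exists (Atom n).
by rewrite /sd (_ : bset (Atom n) = [set w | z w n])// setDv setU0 measure0 lte_fin.
Qed.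

(** Approximations with summable errors are, by the Borel-Cantelli lemma,
    eventually exact almost everywhere. *)
Lemma set_coding A : <<s [set A | exists n, A = [set w | z w n]] >> A ->
  exists a, {ae P, forall w, eventually_true (z w) a <-> A w}.
Proof.
move=> /approximable_sigma[mA Ae].
have /choice[t te] : forall n, exists t, P (sd A (bset t)) < (1 / (2 ^ n.+1)%:R)%:E.
  move=> n; apply: Ae; by rewrite divr_gt0// ltr0n expn_gt0.
exists (fun n => bform_code (t n)); pose F n := sd A (bset (t n)).
have mF n : measurable (F n) by exact: msd.
exists (lim_sup_set F); split.
- apply: bigcap_measurable => // n _; exact: bigcup_measurable.
- apply: lim_sup_set_cvg0 => //.
  apply: (@le_lt_trans _ _ (\sum_(n <oo) (1 / (2 ^ n.+1)%:R)%:E)).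
    by apply: lee_nneseries => // n _; exact/ltW/te.
  by apply: le_lt_trans (epsilon_trick0 predT (@ler01 R)) _; rewrite ltry.
- move=> w /= nw n _; apply: contrapT => nF; apply: nw.
  have Fi i : (n <= i)%N -> A w <-> beval (z w) (t i).
    move=> ni; apply: contrapT => H; apply: nF; exists i => //.
    rewrite /F /sd /bset /=; have [|] := pselect (A w);
      have [|] := pselect (beval (z w) (t i)); tauto.
  split=> [[m mP]|Aw].
    apply/(Fi (maxn m n)); first exact: leq_maxr.
    by have := mP (maxn m n) (leq_maxl _ _); rewrite bform_codeK.
  by exists n => i ni; rewrite bform_codeK; apply/Fi.
Qed.

Lemma function_coding (v : T -> nat -> nat) :
  (forall i k, <<s [set A | exists n, A = [set w | z w n]] >> [set w | v w i = k]) ->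
  exists a, {ae P, forall w, decode (z w) a = v w}.
Proof.
move=> mv.
have /choice[a aP] (ik : nat * nat) := set_coding (mv ik.1 ik.2).
exists (fun n => if unpickle n is Some (i, k, m) then a (i, k) m else 0%N).
have : {ae P, forall w (ik : nat * nat), 
   eventually_true (z w) (a ik) <-> v w ik.1 = ik.2}.
  have : {ae P, forall w n, if unpickle n is Some ik then
      eventually_true (z w) (a ik) <-> v w ik.1 = ik.2 else True}.
    apply: ae_foralln => n; case: (unpickle n) => [ik|]; first exact: aP.
    by apply: filterE.
  by apply: filterS => w H ik; have := H (pickle ik); rewrite pickleK.
apply: filterS => w H; apply/funext => i; rewrite /decode.
under eq_fun do under eq_fun do rewrite pickleK.
apply: least_uniq; first exact/(H (i, v w i)).
by move=> j ji /(H (i, j)) /= vj; rewrite vj ltnn in ji.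
Qed.

End coding.

(** * Borel spaces *)

(** The indexing by naturals, rather than mere countability of the base, is
    what gives the observations of a state their numbering. *)
Definition countable_base (S : topologicalType) (B : nat -> set S) :=
  (forall n, open (B n)) /\
  forall O x, open O -> O x -> exists n, B n x /\ B n `<=` O.

Lemma countable_base_prod (S1 S2 : topologicalType) B1 B2 :
  @countable_base S1 B1 -> @countable_base S2 B2 ->
  countable_base (fun n => if unpickle n is Some (i, j) then B1 i `*` B2 j
    else set0 : set (S1 * S2)).
Proof.
move=> [oB1 B1P] [oB2 B2P]; split=> [n|O [x y] oO Oxy].
  case: (unpickle n) => [[i j]|]; last exact: open0.
  rewrite openE => -[x y] [Bx By]; exists (B1 i, B2 j) => //.
  by split; apply: open_nbhs_nbhs; split=> //; [exact: oB1|exact: oB2].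
have [[/= U V] [Ux Vy] UVO] : nbhs (x, y) O by exact: open_nbhs_nbhs.
have [i [Bix BiU]] := B1P _ _ (open_interior U) Ux.
have [j [Bjy BjV]] := B2P _ _ (open_interior V) Vy.
exists (pickle (i, j)); rewrite pickleK; split=> // -[u v] [/= Bu Bv].
by apply: UVO; split; apply: interior_subset; [exact: BiU|exact: BjV].
Qed.

Lemma open_base_prod (S1 S2 : topologicalType) B1 B2 (O : set (S1 * S2)) :
  @countable_base S1 B1 -> @countable_base S2 B2 -> open O ->
  O = [set p | exists i j, B1 i `*` B2 j `<=` O /\ (B1 i `*` B2 j) p].
Proof.
move=> b1 b2 oO; apply/seteqP; split=> [p Op|p [i [j [+]]]]; last exact.
have [n] := (countable_base_prod b1 b2).2 O p oO Op.
by case: (unpickle n) => [[i j] [? ?]|[]//]; exists i, j.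
Qed.

Lemma measurable_rectangles d1 d2 (M1 : measurableType d1) (M2 : measurableType d2)
    (A : nat -> set M1) (C : nat -> set M2) (Q : nat -> nat -> Prop) :
  (forall i, measurable (A i)) -> (forall j, measurable (C j)) ->
  measurable [set p | exists i j, Q i j /\ (A i `*` C j) p].
Proof.
move=> mA mC; apply: measurable_exists => i; apply: measurable_exists => j.
by apply: measurable_and_prop => _; exact: measurableX.
Qed.

Lemma open_borel (S : ptopologicalType) (O : set S) :
  open O -> measurable (O : set (borel S)).
Proof. by move=> oO; apply: sub_sigma_algebra. Qed.

Lemma measurable_fun_borel (S : ptopologicalType) d (M : measurableType d)
    (h : M -> borel S) :
  (forall O : set S, open O -> measurable (h @^-1` O)) -> measurable_fun setT h.
Proof.
move=> mh; apply: (@measurability _ _ _ (borel S) _ _ (@open S)) => //.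
by move=> _ [V oV <-]; rewrite setTI; exact: mh.
Qed.

Section borel_measurability.
Context (S S1 S2 S3 : ptopologicalType).

Context B1 (b1 : @countable_base S1 B1) B2 (b2 : @countable_base S2 B2).

Lemma open_measurable_prod (O : set (S1 * S2)) :
  open O -> measurable (O : set (borel S1 * borel S2)).
Proof.
move=> oO; rewrite (open_base_prod b1 b2 oO).
apply: (@measurable_rectangles _ _ (borel S1) (borel S2) B1 B2
  (fun i j => B1 i `*` B2 j `<=` O)) => n.
  by apply: open_borel; exact: b1.1.
by apply: open_borel; exact: b2.1.
Qed.

Context B3 (b3 : @countable_base S3 B3).

Lemma open_measurable_prod3 (O : set (S1 * S2 * S3)) :
  open O -> measurable (O : set (borel S1 * borel S2 * borel S3)).
Proof.
move=> oO; have := countable_base_prod b1 b2.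
set B12 := (X in countable_base X) => b12.
rewrite (open_base_prod b12 b3 oO).
apply: (@measurable_rectangles _ _ (borel S1 * borel S2)%type (borel S3) B12 B3
  (fun i j => B12 i `*` B3 j `<=` O)) => n; last by apply: open_borel; exact: b3.1.
by apply: open_measurable_prod; exact: b12.1.
Qed.

Lemma continuous_measurable_prod3 (f : S1 * S2 * S3 -> S) : continuous f ->
  measurable_fun setT (f : borel S1 * borel S2 * borel S3 -> borel S).
Proof.
move=> /continuousP cf; apply: measurable_fun_borel => O oO.
by apply: open_measurable_prod3; exact: cf.
Qed.

Lemma continuous_measurable_prod (R : realType) (g : S1 * S2 -> R) :
  continuous g -> measurable_fun setT (g : borel S1 * borel S2 -> R).
Proof.
move=> /continuousP cg.
apply: (measurability _ (RGenOpens.measurableE R)) => _ [_ [a [b ->] <-]].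
by rewrite setTI; apply: open_measurable_prod; apply: cg; exact: interval_open.
Qed.

End borel_measurability.

Section borel_spaces.
Context (R : realType) (S : ptopologicalType) (Y : completePseudoMetricType R).
Context (h : S -> Y) (D : set Y).
Hypotheses (hausY : hausdorff_space Y) (cD : countable D) (dD : dense D).
Hypotheses (hinj : injective h) (mh : measurable (range h : set (borel Y))).
Hypothesis hE : forall A : set S,
  open A <-> exists2 B : set Y, open B & A = h @^-1` B.

Let r (i : nat) : R := i.+1%:R^-1.

Let r_gt0 i : 0 < r i. Proof. by rewrite invr_gt0. Qed.

Let r_lt (e : R) : 0 < e -> exists i0, forall i, (i0 <= i)%N -> r i < e.
Proof.
move=> e0; exists (Num.truncn e^-1) => i ie.
rewrite /r invf_plt ?posrE//; apply: lt_le_trans (truncnS_gt _) _.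
by rewrite ler_nat.
Qed.

Let dense_seq : exists y : nat -> Y, forall O x, open O -> O x ->
  exists n, O (y n).
Proof.
have /countable_injP[e einj] := cD.
exists (fun n => xget (h point) [set p | D p /\ e p = n]) => O x oO Ox.
have [||p [Op Dp]] := dD (O := O) => //; first by exists x.
exists (e p); case: xgetP => [q _ [Dq /einj]|/(_ p)].
  by rewrite !inE => /(_ Dq Dp) ->.
by move=> /= np; exfalso; apply: np.
Qed.

Let y := projT1 (cid dense_seq).

Let y_dense x e : 0 < e -> exists n, (ball (y n) e)° x.
Proof.
move=> e0; have e2 : 0 < e / 2 by rewrite divr_gt0.
have [n yn] := projT2 (cid dense_seq) _ x (open_interior (ball x (e / 2)))
  (nbhsx_ballx _ _ e2).
exists n; apply/nbhs_ballP; exists (e / 2) => //= p xp.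
rewrite (splitr e); apply: ball_triangle xp; apply: ball_sym.
exact: interior_subset yn.
Qed.

Lemma borel_space_base : exists B, countable_base (B : nat -> set S).
Proof.
exists (fun n => if unpickle n is Some (i, j)
  then h @^-1` (ball (y i) (r j))° else set0).
split=> [n|O x /hE[V oV ->] /= Vx].
  case: (unpickle n) => [[i j]|]; last exact: open0.
  by apply/hE; exists (ball (y i) (r j))°; [exact: open_interior|].
have /nbhs_ballP[e /= e0 eV] : nbhs (h x) V by exact: open_nbhs_nbhs.
have [j0 /(_ j0 (leqnn _)) rj] := r_lt (divr_gt0 e0 (@ltr0Sn R 1)).
have [n yn] := y_dense (h x) (r_gt0 j0).
exists (pickle (n, j0)); rewrite pickleK; split=> // u /= /interior_subset yu.
apply: eV; apply: (le_ball (e1 := r j0 + r j0)).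
  by rewrite [leRHS]splitr lerD// ltW.
apply: ball_triangle yu; apply: ball_sym; exact: interior_subset yn.
Qed.

Let code (s : S) (i : nat) : nat :=
  least (fun n => (ball (y n) (r i))° (h s)).

Let codeP s i : ball (y (code s i)) (r i) (h s).
Proof.
by have [/interior_subset] := leastP (y_dense (h s) (r_gt0 i)).
Qed.

Let measurable_code : measurable_coords (code : borel S -> _).
Proof.
move=> i k; apply: measurable_least => n.
by apply: open_borel; apply/hE; exists (ball (y n) (r i))°; [exact: open_interior|].
Qed.

(** The sequences whose designated approximations are compatible with each
    other; by completeness they converge. *)
Let G := [set a : Baire |
  forall i j, ball (y (a i)) (r i + r j) (y (a j))].

(** The radius is twice [r i] because the limit of a compatible sequence is
    only known to lie within every radius larger than [r i]. *)
Let approximates (a : nat -> nat) p := forall i, ball (y (a i)) (2 * r i) p.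

Let code_G s : G (code s).
Proof. by move=> i j; apply: ball_triangle (codeP s i) (ball_sym (codeP s j)). Qed.

Let code_approximates s : approximates (code s) (h s).
Proof.
move=> i; apply: le_ball (codeP s i); rewrite mulr2n mulrDl !mul1r lerDl.
exact: ltW.
Qed.

Let approximates_uniq a p q : approximates a p -> approximates a q -> p = q.
Proof.
move=> ap aq; apply: (close_eq hausY); rewrite ball_close => e.
have [i /(_ i (leqnn _)) ri] := r_lt (divr_gt0 (gt0 e) (@ltr0Sn R 3)).
apply: (le_ball (e1 := 2 * r i + 2 * r i)); first by lra.
exact: ball_triangle (ball_sym (ap i)) (aq i).
Qed.

Let approximates_ex a : G a -> exists p, approximates a p.
Proof.
move=> Ga; have /cauchy_cvg/cvg_ex[p yp] : cauchy ((fun j => y (a j)) @ \oo).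
  apply/cauchyP => e e0.
  have [i ri] := r_lt (divr_gt0 e0 (@ltr0Sn R 1)).
  exists (y (a i)); exists i => // j ij /=; apply: le_ball (Ga i j).
  by rewrite [leRHS]splitr lerD// ltW// ri.
exists p => i.
have r2 : 0 < r i / 2 by rewrite divr_gt0.
have [j0 rj] := r_lt r2.
have : \forall j \near \oo, ball p (r i / 2) (y (a j)).
  by apply: yp; exact: nbhsx_ballx.
move=> [j1 _ /(_ (maxn j0 j1) (leq_maxr _ _)) /= pj].
have {}rj := rj _ (leq_maxl j0 j1).
apply: (le_ball (e1 := r i + r (maxn j0 j1) + r i / 2)); first by lra.
by apply: ball_triangle (Ga _ _) (ball_sym pj).
Qed.

Let lim (a : Baire) : Y := xget (h point) [set p | approximates a p].

Let limP a : G a -> approximates a (lim a).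
Proof.
by move=> /approximates_ex[p ap]; rewrite /lim; case: xgetP => [q _ //|/(_ p)].
Qed.

Let measurable_G : measurable G.
Proof.
apply: measurable_forall => i; apply: measurable_forall => j.
apply: (@measurable_iff _ _ [set a : Baire | exists k, [set a : Baire | a i = k] a /\
   [set a : Baire | ball (y k) (r i + r j) (y (a j))] a]).
  by move=> a; split=> [[k [/= -> //]]|]; exists (a i).
apply: measurable_exists => k; apply: measurableI.
  exact: measurable_coords_id.
exact: (@measurable_coord _ _ _ j (fun l => ball (y k) (r i + r j) (y l))
  measurable_coords_id).
Qed.

(** The limit lies in the open set [V] if and only if one of the balls known to
    contain it is included in [V], and each ball depends on a single entry of
    the sequence. *)
Let measurable_lim : measurable_fun G (lim : Baire -> borel Y).
Proof.
apply: (@measurability _ _ _ (borel Y) _ _ (@open Y)) => // _ [V oV <-].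
apply: (@measurable_iff _ _ (G `&` [set a : Baire | exists i,
   [set a : Baire | ball (y (a i)) (2 * r i) `<=` V] a])).
  move=> a; split=> -[Ga]; last first.
    move=> /= Va; split=> //.
    have /nbhs_ballP[e /= e0 eV] : nbhs (lim a) V by exact: open_nbhs_nbhs.
    have [i /(_ i (leqnn _)) ri] := r_lt (divr_gt0 e0 (@ltr0Sn R 3)).
    exists i => p yp; apply: eV; apply: (le_ball (e1 := 2 * r i + 2 * r i)).
      by lra.
    exact: ball_triangle (ball_sym (limP Ga i)) yp.
  by move=> [i /= iV]; split=> //=; apply: iV; exact: limP.
apply: measurableI; first exact: measurable_G.
apply: measurable_exists => i.
exact: (@measurable_coord _ _ _ i (fun l => ball (y l) (2 * r i) `<=` V)
  measurable_coords_id).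
Qed.

Let decode_point (a : Baire) : S :=
  xget point [set s | G a /\ h s = lim a].

Let decode_code : cancel code decode_point.
Proof.
move=> s; have Gs := code_G s.
have hs : h s = lim (code s).
  exact: approximates_uniq (code_approximates s) (limP Gs).
rewrite /decode_point; case: xgetP => [t _ [_]|/(_ s)].
  by rewrite -hs => /hinj.
by move=> /= ns; exfalso; apply: ns.
Qed.

Let measurable_decode_point :
  measurable_fun setT (decode_point : Baire -> borel S).
Proof.
apply: measurable_fun_borel => O /hE[V oV ->].
have mlim (A : set (borel Y)) : measurable A -> measurable (G `&` lim @^-1` A).
  by move=> mA; exact: measurable_lim.
apply: (@measurable_iff _ _ ((G `&` lim @^-1` (range h `&` V)) `|`
  (~` (G `&` lim @^-1` range h) `&` [set _ | V (h point)]))); last first.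
  apply: measurableU.
    by apply: mlim; apply: measurableI => //; exact: open_borel.
  apply: measurableI; first exact: (measurableC (mlim _ mh)).
  exact: measurable_prop.
move=> a; rewrite /= /decode_point; case: xgetP => [s _ [Ga hs]|ns].
  rewrite hs; split=> [[[_ [_ //]]|[]]|Va]; last first.
    by left; split=> //; split=> //; exists s.
  by case; split=> //; exists s.
split=> [[[Ga [[s _ hs] _]]|[]//]|Vp].
  by have := ns s; case.
right; split=> // -[Ga [s _ hs]]; exact: (ns s).
Qed.

(** Sequences of naturals without a limit in the range of [h] decode to a
    default point; measurability of this decoding is where the range has to be
    a Borel set. *)
Lemma borel_space_retract : exists (c : S -> nat -> nat) (e : (nat -> nat) -> S),
  [/\ measurable_coords (c : borel S -> _), cancel c e &
      measurable_fun setT (e : Baire -> borel S)].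
Proof. by exists code, decode_point. Qed.

End borel_spaces.

(** * Integrals of functions bounded below, and independence *)

Section integrals.
Context d (T : measurableType d) (R : realType) (P : probability T R).
Local Open Scope ereal_scope.

(** Although [F] need not be integrable, shifting it to a nonnegative function
    changes the integral by a constant. *)
Lemma integral_bounded_below (F : T -> R) (m : R) :
  measurable_fun setT F -> (0 <= m)%R -> (forall w, - m <= F w)%R ->
  \int[P]_w (F w)%:E = \int[P]_w (F w + m)%:E + (- m)%:E.
Proof.
move=> mF m0 mlb; pose f w := (F w)%:E.
have mf : measurable_fun setT f by exact/measurable_EFinP.
have mG : measurable_fun setT (fun w => (F w + m)%:E).
  by apply/measurable_EFinP/measurable_funD.
have G0 w : 0 <= (F w + m)%:E by rewrite lee_fin -lerBlDr sub0r.
have mp : measurable_fun setT (f ^\+) by exact: measurable_funepos.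
have mn : measurable_fun setT (f ^\-) by exact: measurable_funeneg.
have cstE : \int[P]_w m%:E = m%:E.
  by have := expectation_cst P m; rewrite unlock.
have E : \int[P]_w (F w + m)%:E + \int[P]_w f^\- w = \int[P]_w f^\+ w + m%:E.
  rewrite -[in RHS]cstE.
  rewrite -!ge0_integralD//.
  apply: eq_integral => w _; rewrite funeposE funenegE /f -EFinN -!EFin_max.
  by rewrite -!EFinD; congr EFin; rewrite /Num.max; do 2 case: ltP => ?; lra.
have Bfin : \int[P]_w f^\- w \is a fin_num.
  rewrite ge0_fin_numE; last exact: integral_ge0.
  apply: (@le_lt_trans _ _ (\int[P]_w m%:E)); last by rewrite cstE ltry.
  apply: ge0_le_integral => // w _.
  rewrite funenegE ge_max !lee_fin m0 andbT lerNl; exact: mlb.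
rewrite integralE; move: E Bfin.
case: (\int[P]_w f^\- w) => // b; case: (\int[P]_w f^\+ w) => [p| |];
  case: (\int[P]_w (F w + m)%:E) => [q| |] //= -[E] _.
by rewrite -!EFinD; congr EFin; lra.
Qed.

(** Under independence the law of [w |-> (Z w, w)], seen on the product of [X]
    with the sample space equipped with the sigma-algebra generated by [G], is
    a product measure; Tonelli's theorem applies. *)
Lemma independent_integral d' (X : measurableType d') (Z : T -> X)
    (G : set (set T)) (F : X * g_sigma_algebraType G -> \bar R) :
  measurable_fun setT Z -> G `<=` measurable ->
  independent P (sigma_rv Z) <<s G >> ->
  measurable_fun setT F -> (forall p, 0 <= F p) ->
  \int[P]_w F (Z w, w) = \int[pushforward P Z]_x \int[P]_w F (x, w).
Proof.
move=> mZ sG ind mF F0.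
pose S := g_sigma_algebraType G.
have sGm : <<s G >> `<=` @measurable _ T.
  by apply: smallest_sub => //; exact: sigma_algebra_measurable.
have mi : measurable_fun setT (fun w : T => w : S).
  by move=> _ A mA; rewrite setTI; exact: sGm.
have mZi : measurable_fun setT (fun w : T => (Z w, w : S)).
  exact: measurable_fun_pair.
pose Zm : {mfun T >-> X} := HB.pack Z (isMeasurableFun.Build _ _ _ _ _ mZ).
pose im : {mfun T >-> S} :=
  HB.pack (fun w : T => w : S) (isMeasurableFun.Build _ _ _ _ _ mi).
pose Zim : {mfun T >-> (X * S)%type} :=
  HB.pack (fun w : T => (Z w, w : S)) (isMeasurableFun.Build _ _ _ _ _ mZi).
rewrite -[LHS]/(\int[P]_(w in Zim @^-1` setT) (F \o Zim) w).
rewrite -(ge0_integral_pushforward mZi)//.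
rewrite -[LHS]/(\int[distribution P Zim]_w F w).
rewrite -[RHS]/(\int[distribution P Zm]_x \int[P]_w F (x, w)).
have prodE := @product_measure_unique _ _ X S R (distribution P Zm) (distribution P im)
  (distribution P Zim).
rewrite (@eq_measure_integral _ _ _ _
  (distribution P Zm \x distribution P im)); last first.
  move=> A mA _; apply/esym/(prodE _ A mA) => A' B mA' mB.
  rewrite -[LHS]/(P (Zm @^-1` A' `&` B)) ind//.
  by exists A' => //; rewrite setTI.
rewrite fubini_tonelli1//; apply: eq_integral => x _.
rewrite /fubini_F -[LHS]/(\int[pushforward P im]_y F (x, y)).
rewrite (ge0_integral_pushforward mi)//.
exact: measurableT_comp.
Qed.

End integrals.

(** * Coded policies *)

Section coded_policies.
Context (XX UU WW : ptopologicalType) (f : XX * UU * WW -> XX).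
Context (B : nat -> set XX) (e : (nat -> nat) -> UU).

(** The control at time [k] prescribed by the [k]-th slice of the code [a] to a
    controller that has made the observations [z]; [e] turns sequences of
    naturals into controls. *)
Definition coded_control (a : nat -> nat) (k : nat) (z : nat -> bool) : UU :=
  e (decode z (fun n => a (pickle (k, n)))).

(** The first control is prescribed by [u0] and not by the code.  A
    control is matched by a code only almost surely, whereas the first control
    has to be exactly a given function of the state. *)
Definition control (u0 : XX -> UU) (x0 : XX) (a : nat -> nat) (k : nat)
    (z : nat -> bool) : UU :=
  if k is 0 then u0 x0 else coded_control a k z.

Definition observe (k : nat) (x : XX) (n : nat) : bool :=
  if unpickle n is Some (i, m) then (i == k) && `[< B m x >] else false.

(** The truth values of the basic events [B m (x i)] for the times [i] up to
    [k]; the other entries are constant, so that [history x k] carries the same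
    information as the states up to time [k]. *)
Definition history (x : nat -> XX) (k : nat) (n : nat) : bool :=
  if unpickle n is Some (i, m) then (i <= k)%N && `[< B m (x i) >] else false.

(** The closed loop from a deterministic state, with the observations
    accumulated along the way; a function of the state, the code and the noise
    that does not refer to a probability space. *)
Fixpoint run (u0 : XX -> UU) (x0 : XX) (a : nat -> nat) (w : nat -> WW)
    (k : nat) : XX * (nat -> bool) :=
  if k is j.+1 then
    let: (x, z) := run u0 x0 a w j in
    let y := f (x, control u0 x0 a j z, w j) in
    (y, fun n => z n || observe j.+1 y n)
  else (x0, observe 0 x0).

Lemma run_history u0 x0 a w k :
  (run u0 x0 a w k).2 = history (fun i => (run u0 x0 a w i).1) k.
Proof.
elim: k => [|k IH]; apply/funext => n.
  by rewrite /= /observe /history; case: (unpickle n) => [[[|i] m]|].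
rewrite /=; move: IH; case E : (run u0 x0 a w k) => [x z] /= hz.
rewrite [in X in X || _]hz.
rewrite /history /observe; case: (unpickle n) => [[i m]|//].
rewrite [(i <= k.+1)%N]leq_eqVlt ltnS; case: eqP => [->|] /=; last by rewrite orbF.
by rewrite ltnn /= E /=.
Qed.

Definition coded_policy (T : Type) (u0 : XX -> UU) (X0 : T -> XX)
    (A : T -> nat -> nat) (W : nat -> T -> WW) (k : nat) (t : T) : UU :=
  control u0 (X0 t) (A t) k (run u0 (X0 t) (A t) (W^~ t) k).2.

Lemma state_coded_policy d (T : measurableType d) u0 (X0 : T -> XX) A W k t :
  state f X0 W (coded_policy u0 X0 A W) k t =
  (run u0 (X0 t) (A t) (W^~ t) k).1.
Proof.
elim: k => [//|k IH] /=; rewrite IH /coded_policy.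
by case: (run _ _ _ _ k).
Qed.

Hypotheses (bB : countable_base B)
  (mf : measurable_fun setT (f : borel XX * borel UU * borel WW -> borel XX))
  (me : measurable_fun setT (e : Baire -> borel UU)).

Section measurability.
Context (u0 : XX -> UU) (mu0 : measurable_fun setT (u0 : borel XX -> borel UU)).
Context d (M : measurableType d) (x0 : M -> XX) (a : M -> nat -> nat).
Hypotheses (mx0 : measurable_fun setT (x0 : M -> borel XX))
  (ma : measurable_coords a).

Lemma measurable_coded_control k (z : M -> nat -> bool) :
  measurable_bits z ->
  measurable_fun setT ((fun p => coded_control (a p) k (z p)) : M -> borel UU).
Proof.
move=> mz; apply: (measurableT_comp me).
by apply: measurable_fun_Baire; apply: measurable_decode => // i j; exact: ma.
Qed.

Lemma measurable_control k (z : M -> nat -> bool) :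
  measurable_bits z ->
  measurable_fun setT ((fun p => control u0 (x0 p) (a p) k (z p)) : M -> borel UU).
Proof.
case: k => [|k] mz; first exact: (measurableT_comp mu0 mx0).
exact: measurable_coded_control.
Qed.

Lemma measurable_observe k (y : M -> XX) :
  measurable_fun setT (y : M -> borel XX) ->
  measurable_bits (fun p => observe k (y p)).
Proof.
move=> my n; rewrite /observe; case: (unpickle n) => [[i m]|].
  apply: (@measurable_iff _ _ [set p | i = k /\ B m (y p)]).
    move=> p /=; split=> [[-> Bp]|/andP[/eqP-> /asboolP]]; rewrite ?eqxx//.
    exact/asboolP.
  apply: measurable_and_prop => _; rewrite -[X in measurable X]setTI.
  by apply: my => //; apply: open_borel; exact: bB.1.
by apply: (@measurable_iff _ _ set0) => // p /=; split.
Qed.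

Lemma measurable_run (w : M -> nat -> WW) k :
  (forall k, measurable_fun setT ((fun p => w p k) : M -> borel WW)) ->
  measurable_fun setT ((fun p => (run u0 (x0 p) (a p) (w p) k).1) : M -> borel XX) /\
  measurable_bits (fun p => (run u0 (x0 p) (a p) (w p) k).2).
Proof.
move=> mw; elim: k => [|k [IHx IHz]].
  by split=> //=; exact: measurable_observe.
have my : measurable_fun setT
    ((fun p => (run u0 (x0 p) (a p) (w p) k.+1).1) : M -> borel XX).
  have -> : (fun p => (run u0 (x0 p) (a p) (w p) k.+1).1) =
      (fun p => f ((run u0 (x0 p) (a p) (w p) k).1,
        control u0 (x0 p) (a p) k (run u0 (x0 p) (a p) (w p) k).2, w p k)).
    by apply/funext => p /=; case: (run u0 (x0 p) (a p) (w p) k).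
  apply: (measurableT_comp mf).
  apply: measurable_fun_pair; last exact: mw.
  by apply: measurable_fun_pair; [exact: IHx|exact: measurable_control].
split=> // n.
apply: (@measurable_iff _ _ ([set p | (run u0 (x0 p) (a p) (w p) k).2 n] `|`
   [set p | observe k.+1 (run u0 (x0 p) (a p) (w p) k.+1).1 n])).
  by move=> p /=; case: (run u0 (x0 p) (a p) (w p) k) => y z /=; split=> /orP.
by apply: measurableU; [exact: IHz|exact: measurable_observe].
Qed.

End measurability.

Section on_probability_space.
Context d (T : measurableType d) (R : realType) (P : probability T R).

Definition history_events (Y : nat -> T -> XX) (k : nat) : set (set T) :=
  [set A | exists n, A = [set t | history (Y^~ t) k n]].

(** An open set is the union of the basic sets that it contains, so the
    observations generate the whole past. *)
Lemma sigma_of_history (Y : nat -> T -> XX) (k : nat) :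
  sigma_of `I_k.+1 (Y : nat -> T -> borel XX) =
  <<s history_events Y k >>.
Proof.
apply/seteqP; split; apply: smallest_sub; try exact: smallest_sigma_algebra.
  move=> A [i /= ik [C mC <-]]; rewrite setTI.
  pose M := g_sigma_algebraType (history_events Y k).
  suff mY : measurable_fun setT (Y i : M -> borel XX).
    by have := mY measurableT _ mC; rewrite setTI.
  apply: measurable_fun_borel => O oO.
  apply: (@measurable_iff _ M [set t | exists m, B m `<=` O /\ B m (Y i t)]).
    move=> t; split=> [[m [+]]|Ot]; first exact.
    by have [m [? ?]] := bB.2 _ _ oO Ot; exists m.
  apply: measurable_exists => m; apply: measurable_and_prop => _.
  apply: sub_sigma_algebra; exists (pickle (i, m)); apply/seteqP.
  rewrite /history pickleK -ltnS ik /=.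
  by split=> t /asboolP.
have s0 (Q : set T) : (forall t, ~ Q t) ->
    sigma_of `I_k.+1 (Y : nat -> T -> borel XX) Q.
  move=> Q0; rewrite (_ : Q = set0); first exact: sigma_algebra0.
  by apply/seteqP; split=> t // /Q0.
move=> _ [n ->]; rewrite /history.
case: (unpickle n) => [[i m]|]; last exact: s0.
have [ik|ik] /= := leqP i k; last exact: s0.
apply: sub_sigma_algebra; exists i => //; exists (B m).
  by apply: open_borel; exact: bB.1.
by rewrite setTI; apply/seteqP; split=> t /asboolP.
Qed.

Context (X0 : T -> XX) (W : nat -> T -> WW).
Hypotheses (mX0 : measurable_fun setT (X0 : T -> borel XX))
  (mW : forall k, measurable_fun setT (W k : T -> borel WW)).

(** The code may depend on the initial state, which is always observed. *)
Lemma coded_policy_admissible N u0 (s : borel XX -> nat -> nat) :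
  measurable_fun setT (u0 : borel XX -> borel UU) -> measurable_coords s ->
  admissible f N X0 W (coded_policy u0 X0 (s \o X0) W).
Proof.
move=> mu0 ms k kN.
have mA : measurable_coords (s \o X0) by exact: measurable_coords_comp.
split.
  apply: measurable_control => //.
  by apply: (measurable_run mu0 mX0 mA (w := fun t k => W k t) k _).2.
move=> _ [C mC <-]; rewrite setTI.
set Y := state f X0 W _.
pose S := \bigcup_(i in `I_k.+1)
  preimage_set_system setT (Y i : T -> borel XX) measurable.
pose M := g_sigma_algebraType S.
have mX0' : measurable_fun setT (X0 : M -> borel XX).
  move=> _ D mD; rewrite setTI; apply: sub_sigma_algebra; exists 0%N => //.
  by exists D => //; rewrite setTI.
have mz : measurable_bits (fun t : M => (run u0 (X0 t) (s (X0 t)) (W^~ t) k).2).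
  move=> n; apply: (@measurable_iff _ M [set t | history (Y^~ t) k n]).
    move=> t /=; rewrite run_history (_ : (fun i => _) = Y^~ t)//.
    by apply/funext => i; rewrite /Y state_coded_policy.
  rewrite -[measurable _]/(sigma_of `I_k.+1 (Y : nat -> T -> borel XX) _).
  by rewrite sigma_of_history; apply: sub_sigma_algebra; exists n.
have mA' : measurable_coords (fun t : M => s (X0 t)).
  exact: (measurable_coords_comp mX0' ms).
have := measurable_control mu0 mX0' mA' k mz.
by move=> /(_ measurableT _ mC); rewrite setTI.
Qed.

End on_probability_space.
End coded_policies.

(** * Costs of coded policies *)

Lemma eq_history (XX : ptopologicalType) (B : nat -> set XX) x y k :
  (forall i, (i <= k)%N -> x i = y i) -> history B x k = history B y k.
Proof.
move=> xy; apply/funext => n; rewrite /history.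
case: (unpickle n) => [[i m]|//].
by have [ik|//] := leqP i k; rewrite xy.
Qed.

Section costs.
Context (XX UU WW : ptopologicalType) (f : XX * UU * WW -> XX).
Context (B : nat -> set XX) (e : (nat -> nat) -> UU) (c : UU -> nat -> nat).
Context d (T : measurableType d) (R : realType) (P : probability T R).
Context (g : XX * UU -> R) (m : R).
Hypotheses (bB : countable_base B)
  (mf : measurable_fun setT (f : borel XX * borel UU * borel WW -> borel XX))
  (me : measurable_fun setT (e : Baire -> borel UU))
  (mc : measurable_coords (c : borel UU -> nat -> nat)) (cK : cancel c e)
  (mg : measurable_fun setT (g : borel XX * borel UU -> R))
  (m_ge0 : 0 <= m) (g_lb : forall p, - m <= g p).

(** The cost of a run, shifted by [m] at each stage to make it
    nonnegative. *)
Definition excess N u0 (x0 : XX) (a : nat -> nat) (w : nat -> WW) : \bar R :=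
  (\sum_(k < N) (g ((run f B e u0 x0 a w k).1,
     control e u0 x0 a k (run f B e u0 x0 a w k).2) + m)%:E)%E.

Lemma excess_ge0 N u0 x0 a w : (0 <= excess N u0 x0 a w)%E.
Proof.
by apply: sume_ge0 => k _; rewrite lee_fin -lerBlDr sub0r.
Qed.

Lemma measurable_excess N u0 d' (M : measurableType d') (x0 : M -> XX)
    (a : M -> nat -> nat) (w : M -> nat -> WW) :
  measurable_fun setT (u0 : borel XX -> borel UU) ->
  measurable_fun setT (x0 : M -> borel XX) -> measurable_coords a ->
  (forall k, measurable_fun setT ((fun p => w p k) : M -> borel WW)) ->
  measurable_fun setT (fun p => excess N u0 (x0 p) (a p) (w p)).
Proof.
move=> mu0 mx0 ma mw; apply: emeasurable_sum => k.
have [mx mz] := measurable_run bB mf me mu0 mx0 ma k mw.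
apply/measurable_EFinP/measurable_funD; last exact: measurable_cst.
apply: (measurableT_comp mg); apply: measurable_fun_pair; first exact: mx.
exact: measurable_control.
Qed.

Section start.
Context (X0 : T -> XX) (W : nat -> T -> WW).
Hypotheses (mX0 : measurable_fun setT (X0 : T -> borel XX))
  (mW : forall k, measurable_fun setT (W k : T -> borel WW)).

Lemma cost_coded_policy N u0 (A : T -> nat -> nat) :
  measurable_fun setT (u0 : borel XX -> borel UU) -> measurable_coords A ->
  cost P f g N X0 W (coded_policy f B e u0 X0 A W) =
  (\int[P]_t excess N u0 (X0 t) (A t) (W^~ t) + \sum_(k < N) (- m)%:E)%E.
Proof.
move=> mu0 mA; rewrite /cost /excess ge0_integral_sum//; last 2 first.
- move=> k.
  have [mx mz] :=
    measurable_run bB mf me mu0 mX0 mA k (w := fun t k => W k t) mW.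
  apply/measurable_EFinP/measurable_funD; last exact: measurable_cst.
  apply: (measurableT_comp mg); apply: measurable_fun_pair; first exact: mx.
  exact: measurable_control.
- by move=> k t _; rewrite lee_fin -lerBlDr sub0r.
rewrite -big_split /=; apply: eq_bigr => k _.
rewrite /stage_cost unlock.
have [mx mz] := measurable_run bB mf me mu0 mX0 mA k (w := fun t k => W k t) mW.
rewrite -integral_bounded_below//; last first.
  apply: (measurableT_comp mg); apply: measurable_fun_pair; first exact: mx.
  exact: measurable_control.
by apply: eq_integral => t _; rewrite state_coded_policy.
Qed.

Lemma measurable_state N U : admissible f N X0 W U ->
  forall k, (k <= N)%N -> measurable_fun setT (state f X0 W U k : T -> borel XX).
Proof.
move=> admU; elim=> [//|k IH] kN /=.
apply: (measurableT_comp mf); apply: measurable_fun_pair; last exact: mW.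
apply: measurable_fun_pair; first exact/IH/ltnW.
by have [] := admU k kN.
Qed.

(** The control at time [k], encoded by [c], is a function of the past, and
    the past is generated by the observations. *)
Lemma admissible_coding N U : admissible f N X0 W U ->
  exists a, {ae P, forall t k, (k < N)%N ->
    U k t = coded_control e a k (history B ((state f X0 W U)^~ t) k)}.
Proof.
move=> admU; set Y := state f X0 W U.
have /choice[a aP] k : exists a, (k < N)%N ->
    {ae P, forall t, decode (history B (Y^~ t) k) a = c (U k t)}.
  have [kN|] := ltnP k N; last by exists (fun=> 0%N).
  have [mU sU] := admU k kN.
  have mz : measurable_bits (fun t => history B (Y^~ t) k).
    move=> n; rewrite /history; case: (unpickle n) => [[i l]|]; last first.
      by apply: (@measurable_iff _ _ set0) => // t /=; split.
    have [ik|ik] /= := leqP i k; last first.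
      by apply: (@measurable_iff _ _ set0) => // t /=; split.
    apply: (@measurable_iff _ _ (setT `&` Y i @^-1` B l)).
      by move=> t /=; split=> [[_ ?]|/asboolP//]; apply/asboolP.
    apply: (measurable_state admU) => //; first exact: leq_trans (ltnW kN).
    by apply: open_borel; exact: bB.1.
  have [|a aP] := @function_coding _ T R P _ mz (fun t => c (U k t)); last by exists a.
  move=> i l; rewrite -/(history_events B Y k _) -(sigma_of_history bB).
  apply: sU; exists [set u : borel UU | c u i = l]; first exact: mc.
  by rewrite setTI.
exists (fun n => if unpickle n is Some (k, l) then a k l else 0%N).
apply: ae_foralln => k; have [kN|] := ltnP k N; last first.
  by move=> _; apply: filterE => t.
apply: filterS (aP k kN) => t at_ _; rewrite /coded_control.
by rewrite (_ : (fun n => _) = a k) ?at_ ?cK//; apply/funext => n; rewrite pickleK.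
Qed.

(** Replacing each control by its coded version changes the controls on null
    sets only, hence also the states, by induction on time. *)
Lemma cost_coding N U u0 a : admissible f N X0 W U ->
  measurable_fun setT (u0 : borel XX -> borel UU) ->
  {ae P, forall t k, (k < N)%N ->
    U k t = coded_control e a k (history B ((state f X0 W U)^~ t) k)} ->
  {ae P, forall t, U 0%N t = u0 (X0 t)} ->
  cost P f g N X0 W U =
  cost P f g N X0 W (coded_policy f B e u0 X0 (cst a) W).
Proof.
move=> admU mu0 Ua U0; set Y := state f X0 W U.
set V := coded_policy f B e u0 X0 (cst a) W.
have ma : measurable_coords (cst a : borel XX -> nat -> nat).
  exact: measurable_coords_cst.
have admV : admissible f N X0 W V by exact: coded_policy_admissible.
have UV : {ae P, forall t, forall k, (k <= N)%N -> Y k t = state f X0 W V k t} /\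
    {ae P, forall t, forall k, (k < N)%N -> U k t = V k t}.
  have H : {ae P, forall t, (forall k, (k <= N)%N -> Y k t = state f X0 W V k t) /\
      forall k, (k < N)%N -> U k t = V k t}.
    move: Ua U0; apply: filterS2 => t Ut U0t.
    have UVk k : (k < N)%N ->
        (forall i, (i <= k)%N -> Y i t = state f X0 W V i t) -> U k t = V k t.
      move=> kN Yi; rewrite /V /coded_policy run_history.
      case: k kN Yi => [//|k] kN Yi; rewrite Ut//; congr coded_control.
      by apply: eq_history => i ik; rewrite -state_coded_policy; exact: Yi.
    have Yk k : (k <= N)%N -> forall i, (i <= k)%N -> Y i t = state f X0 W V i t.
      elim: k => [|k IH] kN i; first by rewrite leqn0 => /eqP->.
      rewrite leq_eqVlt => /orP[/eqP->|ik]; last by apply: IH => //; exact: ltnW.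
      have Yt := IH (ltnW kN).
      by rewrite /Y /= -/(Y k t) (Yt k (leqnn k)) (UVk k kN Yt).
    by split=> k kN; [exact: (Yk k kN)|exact: (UVk k kN (Yk k (ltnW kN)))].
  by split; apply: filterS H => t [].
apply: eq_bigr => k _; rewrite /stage_cost unlock.
apply: ae_eq_integral => //.
- apply/measurable_EFinP; apply: (measurableT_comp mg).
  apply: measurable_fun_pair; first exact: (measurable_state admU (ltnW _)).
  by have [] := admU k (ltn_ord k).
- apply/measurable_EFinP; apply: (measurableT_comp mg).
  apply: measurable_fun_pair; first exact: (measurable_state admV (ltnW _)).
  by have [] := admV k (ltn_ord k).
- move: UV => []; apply: filterS2 => t Yt Ut _.
  by rewrite -/Y Yt ?Ut// ltnW.
Qed.

End start.
End costs.

(** * First controls of optimal policies *)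

Lemma history0 (XX : ptopologicalType) (B : nat -> set XX) x :
  history B x 0 = observe B 0 (x 0%N).
Proof.
apply/funext => n; rewrite /history /observe.
by case: (unpickle n) => [[[|i] l]|].
Qed.

Section lift.
Context d (T : measurableType d) (R : realType) (P : probability T R).
Context (XX UU WW : ptopologicalType).
Hypotheses (bXX : borel_space R XX) (bUU : borel_space R UU)
  (bWW : borel_space R WW).
Context (f : XX * UU * WW -> XX) (g : XX * UU -> R).
Hypotheses (f_cont : continuous f) (g_cont : continuous g)
  (g_lb : exists m : R, forall z, m <= g z).
Context (PW : probability (borel WW) R) (N : nat).
Hypothesis N_gt0 : (0 < N)%N.

(** The same noise drives the system from a constant initial state, so the
    pathwise minimizers and the given one live on the same sample space. *)
Lemma noise_cst (X : T -> XX) (W : nat -> T -> WW) (x : XX) :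
  noise P PW X W -> noise P PW (cst x) W.
Proof.
move=> [iidW _]; split=> // _ B [A mA <-] _; rewrite setTI.
have [Ax|Ax] := pselect (A x).
  by rewrite (_ : _ @^-1` A = setT) ?setTI ?probability_setT ?mul1e//;
    apply/seteqP; split.
by rewrite (_ : _ @^-1` A = set0) ?set0I ?measure0 ?mul0e//; apply/seteqP; split.
Qed.

(** With [b] a code of the given minimizer [U0] and [u0] its first control, the
    selection is made among the codes [a] for which the policy [(mu, a)] does
    at least as well from [x] as the policy [(u0, b)]. *)
Lemma pathwise_first_control (mu : XX -> UU) (X : T -> XX) (W : nat -> T -> WW)
    (U0 : nat -> T -> UU) :
  measurable_fun setT (mu : borel XX -> borel UU) ->
  pathwise_mpc_law P f g PW N mu ->
  random_variables T XX X -> noise P PW X W -> minimizer P f g N X W U0 ->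
  exists2 U, minimizer P f g N X W U & U 0%N = mu \o X.
Proof.
move=> mmu mu_law mX XW [admU0 minU0].
have [Y1 [h1 [haus1 [D1 cD1 dD1] inj1 mr1 hE1]]] := bXX.
have [Y2 [h2 [haus2 [D2 cD2 dD2] inj2 mr2 hE2]]] := bUU.
have [Y3 [h3 [haus3 [D3 cD3 dD3] inj3 mr3 hE3]]] := bWW.
have [B bB] := borel_space_base cD1 dD1 hE1.
have [BU bBU] := borel_space_base cD2 dD2 hE2.
have [BW bBW] := borel_space_base cD3 dD3 hE3.
have [c [e [mc cK me]]] := borel_space_retract haus2 cD2 dD2 inj2 mr2 hE2.
have mf := continuous_measurable_prod3 bB bBU bBW f_cont.
have mg := continuous_measurable_prod bB bBU g_cont.
have [m [m0 glb]] : exists m : R, 0 <= m /\ forall p, - m <= g p.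
  have [m gm] := g_lb; exists `|m|; split=> // p.
  by rewrite (le_trans _ (gm p))// lerNl -normrN ler_norm.
have [[mW _ _] indXW] := XW.
pose EE u0 x a := (\int[P]_t excess f B e g m N u0 x a (W^~ t))%E.
pose c0 : \bar R := (\sum_(k < N) (- m)%:E)%E.
have c0fin : c0 \is a fin_num by rewrite /c0 sumEFin.
have EE0 u0 x a : (0 <= EE u0 x a)%E.
  by apply: integral_ge0 => t _; exact: excess_ge0.
have mEE u0 d' (M : measurableType d') (x : M -> XX) (a : M -> nat -> nat) :
    measurable_fun setT (u0 : borel XX -> borel UU) ->
    measurable_fun setT (x : M -> borel XX) -> measurable_coords a ->
    measurable_fun setT (fun p => EE u0 (x p) (a p)).
  move=> mu0 mx ma.
  pose F (q : M * T) := excess f B e g m N u0 (x q.1) (a q.1) (W^~ q.2).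
  have mF : measurable_fun setT F.
    apply: (measurable_excess m bB mf me mg) => //.
    - exact: (measurableT_comp mx measurable_fst).
    - exact: (measurable_coords_comp measurable_fst ma).
    - by move=> k; exact: (measurableT_comp (mW k) measurable_snd).
  apply: (@measurable_fun_fubini_tonelli_F _ _ _ _ _ P F mF) => q.
  exact: excess_ge0.
have ma_cst d' (M : measurableType d') (a : nat -> nat) :
  measurable_coords (fun _ : M => a) by exact: measurable_coords_cst.
have costE u0 x a : measurable_fun setT (u0 : borel XX -> borel UU) ->
    cost P f g N (cst x) W (coded_policy f B e u0 (cst x) (cst a) W) =
    (EE u0 x a + c0)%E.
  move=> mu0.
  have mx : measurable_fun setT (cst x : T -> borel XX) by exact: measurable_cst.
  by rewrite (cost_coded_policy P bB mf me mg m0 glb mx mW)//; exact: ma_cst.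
have costX u0 (s : borel XX -> nat -> nat) :
    measurable_fun setT (u0 : borel XX -> borel UU) -> measurable_coords s ->
    cost P f g N X W (coded_policy f B e u0 X (s \o X) W) =
    (\int[pushforward P (X : T -> borel XX)]_x EE u0 x (s x) + c0)%E.
  move=> mu0 ms.
  rewrite (cost_coded_policy P bB mf me mg m0 glb mX mW)//; last first.
    exact: measurable_coords_comp.
  congr (_ + _)%E.
  pose G := \bigcup_(i in setT) preimage_set_system setT (W i : T -> borel WW) measurable.
  have mWG k : measurable_fun setT (W k : g_sigma_algebraType G -> borel WW).
    by move=> _ A mA; apply: sub_sigma_algebra; exists k => //; exists A.
  pose F (q : borel XX * g_sigma_algebraType G) :=
    excess f B e g m N u0 q.1 (s q.1) (W^~ q.2).
  apply: (@independent_integral _ _ _ P _ (borel XX) X G F) => //.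
  - by move=> _ [i _ [A mA <-]]; exact: mW.
  - apply: (measurable_excess m bB mf me mg) => //.
      exact: (measurable_coords_comp measurable_fst ms).
    by move=> k; exact: (measurableT_comp (mWG k) measurable_snd).
  - by move=> p; exact: excess_ge0.
have [b bP] := admissible_coding P bB mf mc cK mX mW admU0.
pose u0 x := coded_control e b 0 (observe B 0 x).
have mu0 : measurable_fun setT (u0 : borel XX -> borel UU).
  apply: (measurable_coded_control me (ma_cst _ _ b)).
  exact: measurable_observe.
have costU0 : cost P f g N X W U0 =
    (\int[pushforward P (X : T -> borel XX)]_x EE u0 x b + c0)%E.
  rewrite -(costX u0 (cst b) mu0 (ma_cst _ _ b)).
  apply: (cost_coding bB mf me mg mX mW admU0 mu0 bP).
  apply: filterS bP => t /(_ 0%N N_gt0) ->.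
  by rewrite history0.
(* from [x], the policy of the given minimizer is admissible, and the pathwise
   minimizer is at least as good *)
have better x : exists a, (EE mu x a <= EE u0 x b)%E.
  have [U [admU minU] Ux] := mu_law x W (noise_cst x XW).
  have mx : measurable_fun setT (cst x : T -> borel XX) by exact: measurable_cst.
  have [a aP] := admissible_coding P bB mf mc cK mx mW admU.
  exists a; rewrite -(leeD2rE _ _ c0fin) -!costE//.
  rewrite -(cost_coding bB mf me mg mx mW admU mmu aP); last first.
    by rewrite Ux; apply: filterE.
  rewrite minU; apply: ereal_inf_lbound; eexists; last reflexivity.
  exact: (coded_policy_admissible bB mf me mx mW mu0 (ma_cst _ _ b)).
pose Xm : {mfun T >-> borel XX} :=
  HB.pack (X : T -> borel XX) (isMeasurableFun.Build _ _ _ _ _ mX).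
pose C := [set q : borel XX * Baire | (EE mu q.1 q.2 <= EE u0 q.1 b)%E].
have mC : measurable C.
  rewrite -[C]setTI.
  apply: (measurable_fun_lee _ _ measurableT (Y := [set true])) => //.
    apply: mEE => //.
    exact: (measurable_coords_comp measurable_snd measurable_coords_id).
  by apply: mEE => //; exact: ma_cst.
have [s ms sC] := measurable_selection (distribution P Xm) mC better.
exists (coded_policy f B e mu X (s \o X) W) => //.
have admV : admissible f N X W (coded_policy f B e mu X (s \o X) W).
  exact: (coded_policy_admissible bB mf me mX mW mmu ms).
split=> //; apply/eqP; rewrite eq_le; apply/andP; split; last first.
  by apply: ereal_inf_lbound; eexists; [exact: admV|].
rewrite -minU0 costU0 (costX mu s mmu ms) leeD2rE//.
rewrite -[leLHS]/(\int[distribution P Xm]_x EE mu x (s x))%E.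
rewrite -[leRHS]/(\int[distribution P Xm]_x EE u0 x b)%E.
apply: ae_ge0_le_integral => //.
- exact: mEE.
- by apply: mEE => //; exact: ma_cst.
- by apply: filterS sC => x Cx _.
Qed.

End lift.

Theorem corollary7
  (d : measure_display) (T : measurableType d) (R : realType)
  (P : probability T R)
  (XX UU WW : ptopologicalType)
  (bXX : borel_space R XX) (bUU : borel_space R UU) (bWW : borel_space R WW)
  (f : XX * UU * WW -> XX) (f_cont : continuous f)
  (g : XX * UU -> R) (g_cont : continuous g)
  (g_lb : exists m : R, forall z, m <= g z)
  (PW : probability (borel WW) R)
  (N : nat) (N_gt0 : (0 < N)%N)
  (min_ex : forall X, viable P f g PW X -> forall W, noise P PW X W ->
     exists U, minimizer P f g N X W U)
  (j : nat) (Xinit : T -> XX) (W : nat -> T -> WW) (U : nat -> T -> UU)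
  (Xinit_rv : random_variables T XX Xinit)
  (W_noise : noise P PW Xinit W)
  (U_adm : admissible f j Xinit W U)
  (Xj_viable : viable P f g PW (state f Xinit W U j))
  (mu2 : XX -> UU)
  (mu2_meas : measurable_fun [set: borel XX] (mu2 : borel XX -> borel UU))
  (mu2_law : pathwise_mpc_law P f g PW N mu2) :
  exists mu1 : (T -> XX) -> T -> UU,
    [/\ stochastic_mpc_law P f g PW N mu1,
        coincide_as P (state f Xinit W U j) mu1 mu2 &
        forall (X0 : T -> XX) (W0 : nat -> T -> WW),
          random_variables T XX X0 -> noise P PW X0 W0 ->
          forall K : nat,
            closed_loop_cost P f g K X0 W0 mu1 =
            closed_loop_cost P f g K X0 W0 (lift_law mu2)].
Proof.
exists (lift_law mu2); split.
- split=> [X mX|X Xv W0 XW0].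
    split; first exact: (measurableT_comp mu2_meas mX).
    exact: preimage_set_system_compS.
  have [S /= SE SX] := Xv.
  have mX : random_variables T XX X by move: SX; rewrite SE => -[].
  have [U0 minU0] := min_ex _ Xv _ XW0.
  exact: (pathwise_first_control bXX bUU bWW f_cont g_cont g_lb N_gt0 mu2_meas
    mu2_law mX XW0 minU0).
- exists mu2; split=> //; exists set0; split=> //; last by move=> x [].
  by rewrite /pushforward preimage_set0 measure0.
- by [].
Qed.
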